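(* Let $K$ be a field, let $c \ge 1$ be an integer and let $\mathbf{P} = (\mathbf{X}^{\mathrm{OI},1})^{\otimes c}$. If $\mathbf{M}$ is a finitely generated graded $\mathrm{OI}$-module over $\mathbf{P}$ that is trivial in negative degrees (that is, $[\mathbf{M}_n]_j = 0$ for all $n \ge 0$ and all $j < 0$), then its equivariant Hilbert series is of the form \[ H_{\mathbf{M}} (s, t) = \frac{g(s, t)}{(1-t)^a \cdot \prod_{j =1}^b [(1-t)^{c_j} - s \cdot f_j (t)]}, \] where $a, b, c_j$ are non-negative integers, $g (s, t) \in \mathbb{Z}[s, t]$, and each $f_j (t)$ is a polynomial in $\mathbb{Z}[t]$ satisfying $f_j (1) > 0$ and $f_j (0) = 1$.
   Context: $\mathrm{OI}$ is the category with objects $[n] = \{1,\dots,n\}$, $n \ge 0$ ($[0]=\emptyset$), and morphisms the strictly increasing maps $\varepsilon\colon [m]\to[n]$. The $\mathrm{OI}$-algebra $\mathbf{P} = (\mathbf{X}^{\mathrm{OI},1})^{\otimes c}$ over $K$ is the functor from $\mathrm{OI}$ to commutative $K$-algebras with $\mathbf{P}_n = K[x_{i,j} : 1\le i\le c,\ 1\le j\le n]$ (so $\mathbf{P}_0=K$) and, for $\varepsilon\colon[m]\to[n]$, $\varepsilon_*\colon \mathbf{P}_m\to\mathbf{P}_n$ the $K$-algebra homomorphism with $\varepsilon_*(x_{i,j}) = x_{i,\varepsilon(j)}$. Every variable has degree one. An $\mathrm{OI}$-module $\mathbf{M}$ over $\mathbf{P}$ is a functor from $\mathrm{OI}$ to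 $K$-vector spaces such that each $\mathbf{M}_n = \mathbf{M}([n])$ is a $\mathbf{P}_n$-module and $\mathbf{M}(\varepsilon)(aq) = \varepsilon_*(a)\,\mathbf{M}(\varepsilon)(q)$ for all $\varepsilon\colon[m]\to[n]$, $a\in\mathbf{P}_m$, $q\in\mathbf{M}_m$. It is graded if every $\mathbf{M}_n$ is a $\mathbb{Z}$-graded $\mathbf{P}_n$-module and every $\mathbf{M}(\varepsilon)$ is homogeneous of degree $0$. It is finitely generated if there is a finite subset of $\coprod_n \mathbf{M}_n$ that is not contained in any proper $\mathrm{OI}$-submodule. $[\mathbf{M}_n]_j$ is the degree $j$ component of $\mathbf{M}_n$. The equivariant Hilbert series is the formal power series $H_{\mathbf{M}}(s,t) = \sum_{n\ge0,\,j\in\mathbb{Z}} \dim_K[\mathbf{M}_n]_j\, s^n t^j$. *)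

(* Defs.v *)
From HB Require Import structures.
From mathcomp Require Import all_boot all_order all_algebra.
From mathcomp Require Import mpoly.

Set Implicit Arguments.
Unset Strict Implicit.
Unset Printing Implicit Defensive.

Import Order.TTheory GRing.Theory Num.Theory.
Local Open Scope ring_scope.

(* The set {1, ..., n} is represented by 'I_n = {0, ..., n-1}. *)
Definition strictly_increasing m n (f : {ffun 'I_m -> 'I_n}) : bool :=
  [forall i : 'I_m, forall j : 'I_m, (i < j)%N ==> (f i < f j)%N].

Definition OIhom m n : Type := {f : {ffun 'I_m -> 'I_n} | strictly_increasing f}.

Definition OIfun m n (e : OIhom m n) : 'I_m -> 'I_n := sval e.
Coercion OIfun : OIhom >-> Funclass.

Lemma OIid_subproof n : strictly_increasing [ffun i : 'I_n => i].
Proof. by apply/forallP=> i; apply/forallP=> j; rewrite !ffunE; apply/implyP. Qed.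

Definition OIid n : OIhom n n :=
  exist (fun f => strictly_increasing f) _ (OIid_subproof n).

Lemma OIcomp_subproof m n p (e2 : OIhom n p) (e1 : OIhom m n) :
  strictly_increasing [ffun i => e2 (e1 i)].
Proof.
apply/forallP=> i; apply/forallP=> j; apply/implyP=> ltij; rewrite !ffunE.
have /forallP/(_ (e1 i))/forallP/(_ (e1 j))/implyP := svalP e2; apply.
by have /forallP/(_ i)/forallP/(_ j)/implyP := svalP e1; apply.
Qed.

Definition OIcomp m n p (e2 : OIhom n p) (e1 : OIhom m n) : OIhom m p :=
  exist (fun f => strictly_increasing f) _ (OIcomp_subproof e2 e1).

Section OIModules.

Variables (K : fieldType) (c : nat).

Definition OIalg (n : nat) := {mpoly K[c * n]}.

Definition OIvar n (i : 'I_c) (j : 'I_n) : OIalg n := 'X_(mxvec_index i j).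

(* The inverse of mxvec_index. *)
Definition OIidx n (k : 'I_(c * n)) : 'I_c * 'I_n :=
  enum_val (cast_ord (esym (mxvec_cast c n)) k).

Definition OIpush m n (e : OIhom m n) (p : OIalg m) : OIalg n :=
  p \mPo [tuple OIvar (OIidx k).1 (e (OIidx k).2) | k < c * m].

Lemma OIpush_var m n (e : OIhom m n) i (j : 'I_m) :
  OIpush e (OIvar i j) = OIvar i (e j).
Proof.
rewrite /OIpush /OIvar comp_mpolyXU -tnth_nth tnth_mktuple.
by rewrite /OIidx /mxvec_index cast_ordK enum_rankK.
Qed.

(* The K-vector space structure of M_n is restriction of scalars along
   K -> P_n; the maps M(e) are then K-linear by oi_mapD and oi_mapZ, since
   OIpush fixes the constants. *)
Record oi_module : Type := OIModule {
  oi_obj :> forall n, lmodType (OIalg n);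
  oi_map : forall m n, OIhom m n -> oi_obj m -> oi_obj n;
  oi_map_id : forall n (q : oi_obj n), oi_map (OIid n) q = q;
  oi_map_comp : forall m n p (e2 : OIhom n p) (e1 : OIhom m n) (q : oi_obj m),
    oi_map (OIcomp e2 e1) q = oi_map e2 (oi_map e1 q);
  oi_mapD : forall m n (e : OIhom m n) (q r : oi_obj m),
    oi_map e (q + r) = oi_map e q + oi_map e r;
  oi_mapZ : forall m n (e : OIhom m n) (a : OIalg m) (q : oi_obj m),
    oi_map e (a *: q) = OIpush e a *: oi_map e q
}.

Record is_oi_submodule (M : oi_module) (N : forall n, M n -> Prop) : Prop := {
  oi_sub0 : forall n, N n 0;
  oi_subD : forall n (q r : M n), N n q -> N n r -> N n (q + r);
  oi_subZ : forall n (a : OIalg n) (q : M n), N n q -> N n (a *: q);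
  oi_sub_map : forall m n (e : OIhom m n) (q : M m), N m q -> N n (oi_map e q)
}.

Definition finitely_generated (M : oi_module) : Prop :=
  exists (r : nat) (w : 'I_r -> nat) (x : forall i, M (w i)),
    forall N : (forall n, M n -> Prop), is_oi_submodule N ->
      (forall i, N (w i) (x i)) ->
      forall n (q : M n), N n q.

(* The last two fields of the grading say that M_n is the internal direct sum
   of its components [M_n]_j, j in Z. *)
Record is_grading (M : oi_module) (G : forall n, int -> M n -> Prop) : Prop := {
  gr_0 : forall n j, G n j 0;
  gr_D : forall n j (q r : M n), G n j q -> G n j r -> G n j (q + r);
  gr_Z : forall n (d : nat) j (a : OIalg n) (q : M n),
    a \is d.-homog -> G n j q -> G n (d%:Z + j) (a *: q);
  gr_map : forall m n (e : OIhom m n) j (q : M m),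
    G m j q -> G n j (oi_map e q);
  gr_sum : forall n (q : M n), exists (s : seq int) (h : int -> M n),
    (forall j, G n j (h j)) /\ q = \sum_(j <- s) h j;
  gr_direct : forall n (s : seq int) (h : int -> M n),
    uniq s -> (forall j, G n j (h j)) -> \sum_(j <- s) h j = 0 ->
    forall j, j \in s -> h j = 0
}.

Record graded_oi_module : Type := GradedOIModule {
  gr_module :> oi_module;
  gr_comp : forall n, int -> gr_module n -> Prop;
  gr_compP : is_grading gr_comp
}.

Definition is_Kdim (M : oi_module) n (V : M n -> Prop) (d : nat) : Prop :=
  exists v : 'I_d -> M n,
    [/\ forall i, V (v i),
        forall k : 'I_d -> K,
          \sum_i (k i)%:MP *: v i = 0 -> forall i, k i = 0
      & forall q, V q -> exists k : 'I_d -> K, q = \sum_i (k i)%:MP *: v i].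

End OIModules.

(* Z[[s, t]]: the series sum_(n, j) (u n j) s^n t^j. *)
Definition fps2 : Type := nat -> nat -> int.

Definition fps2_mul (u v : fps2) : fps2 := fun n j =>
  \sum_(k < n.+1) \sum_(l < j.+1) u k l * v (n - k)%N (j - l)%N.

(* Z[s, t] is {poly {poly int}}, the outer variable being s. *)
Definition fps2_poly (p : {poly {poly int}}) : fps2 := fun n j => p`_n`_j.

(* H = g / d in Z[[s, t]], i.e., d is invertible and H = g * d^-1. *)
Definition fps2_quotient (H g d : fps2) : Prop :=
  exists v : fps2, fps2_mul d v =2 fps2_poly 1 /\ H =2 fps2_mul g v.

(* H_M(s, t) as a power series in t: this is the equivariant Hilbert series only
   when M is trivial in negative degrees. In particular all [M_n]_j, j >= 0, are
   finite-dimensional. *)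
Definition is_hilbert_series K c (M : graded_oi_module K c) (H : fps2) : Prop :=
  forall n j : nat, exists2 d : nat,
    is_Kdim (@gr_comp _ _ M n j%:Z) d & H n j = d%:Z.

Definition trivial_in_negative_degrees K c (M : graded_oi_module K c) : Prop :=
  forall n (j : int) (q : M n), j < 0 -> gr_comp j q -> q = 0.

Definition hilbert_denominator (a b : nat) (e : 'I_b -> nat)
    (f : 'I_b -> {poly int}) : {poly {poly int}} :=
  ((1 - 'X) ^+ a)%:P * \prod_(j < b) (((1 - 'X) ^+ e j)%:P - 'X * (f j)%:P).

(* Main.v *)
Require Import Defs.
From HB Require Import structures.
From mathcomp Require Import all_boot all_order all_algebra.
From mathcomp Require Import mpoly.
From mathcomp Require Import boolp.
From mathcomp Require Import zify ring.

Set Implicit Arguments.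
Unset Strict Implicit.
Unset Printing Implicit Defensive.

Import Order.TTheory GRing.Theory Num.Theory.
Local Open Scope ring_scope.

(** Let [M] be generated by homogeneous elements [y_i] of width [w_i] and degree
    [d_i >= 0]. The vector space [M_n] is spanned by the monomials
    [x^a e_*(y_i)], where [x^a] is a monomial of [P_n] and [e] an OI-morphism from
    [w_i] to [n]. Such a monomial is a word of [n] letters: the letter of a column
    consists of the exponents of its [c] variables and of a mark telling whether
    the column lies in the image of [e]. Order the words lexicographically and
    call a monomial standard if it is not a linear combination of smaller ones of
    the same width and degree. The standard monomials form a basis of each
    [[M_n]_j] ([is_Kdim_standard]), which is the Groebner basis argument stated
    without leading terms.

    Since the order is compatible with multiplication by monomials and with
    OI-morphisms, the standard words on [y_i] form a lower set for divisibility
    ([standard_words_lower]): a divisor is obtained by lowering exponents and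
    deleting unmarked letters, while the [w_i] marked letters stay. The Hilbert
    series is the sum over [i] of [t^(d_i)] times the generating function of that
    language, so it remains to show that the generating function of every lower
    language is of the required form ([lower_language_rational]).

    By Higman's lemma ([wqo_words]) lower languages with a given number of marks
    satisfy the descending chain condition, which allows Noetherian induction on
    the language [L]. Splitting off the first letter expresses the series [G] of
    [L] by those of the derivatives [a^-1 L], the sets of words [u] with [a u] in
    [L]. For a marked letter [a] the derivative has fewer marks. For an unmarked
    [a] it is contained in [L], and it decreases when [a] increases; hence the
    [a] with [a^-1 L = L] form a monomial order ideal. If that ideal is not empty,
    its Hilbert series is [p(t)/(1-t)^e] with [p(0) = 1] and [p(1) > 0], and
    collecting the terms with [G] gives [((1-t)^e - s p(t)) G] in terms of smaller
    languages. This is where the factors of the denominator come from. The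
    infinite sum over the remaining letters has a denominator that is a power of
    [1-t] times those of finitely many smaller languages, since the derivatives
    stabilise in each direction ([exp_sum_antitone]). *)

(** * Rings of formal power series *)

(** An alias of the function type, so that it can carry the convolution
    product. Two-variable series are series in [s] whose coefficients are series
    in [t]; their product is convertible to the double convolution that defines
    the product in Z[[s,t]]. *)
Definition fps (R : Type) : Type := nat -> R.

HB.instance Definition _ (R : Type) := gen_eqMixin (fps R).
HB.instance Definition _ (R : Type) := gen_choiceMixin (fps R).

Section PowerSeriesRing.
Variable R : comNzRingType.
Implicit Types u v w : fps R.

Definition fps_zero : fps R := fun=> 0.
Definition fps_opp u : fps R := fun n => - u n.
Definition fps_add u v : fps R := fun n => u n + v n.
Definition fps_one : fps R := fun n => (n == 0%N)%:R.
Definition fps_mul u v : fps R := fun n => \sum_(k < n.+1) u k * v (n - k)%N.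

Lemma fps_addA : associative fps_add.
Proof. by move=> u v w; apply/funext=> n; apply: addrA. Qed.
Lemma fps_addC : commutative fps_add.
Proof. by move=> u v; apply/funext=> n; apply: addrC. Qed.
Lemma fps_add0 : left_id fps_zero fps_add.
Proof. by move=> u; apply/funext=> n; apply: add0r. Qed.
Lemma fps_addN : left_inverse fps_zero fps_opp fps_add.
Proof. by move=> u; apply/funext=> n; apply: addNr. Qed.

HB.instance Definition _ :=
  GRing.isZmodule.Build (fps R) fps_addA fps_addC fps_add0 fps_addN.

Definition fps_trunc N u : {poly R} := \poly_(i < N) u i.

(** Coefficients of products up to order [N] only involve coefficients up to
    order [N], so the ring laws are inherited from polynomials. *)
Lemma coef_fps_trunc N n (p q : {poly R}) u v : (n < N)%N ->
  (forall i, (i < N)%N -> p`_i = u i) -> (forall i, (i < N)%N -> q`_i = v i) ->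
  (p * q)`_n = fps_mul u v n.
Proof.
move=> ltnN pu qv; rewrite coefM; apply: eq_bigr => k _.
have ltkn := ltn_ord k; rewrite pu ?qv //; lia.
Qed.

Lemma fps_truncE N u i : (i < N)%N -> (fps_trunc N u)`_i = u i.
Proof. by move=> lt; rewrite coef_poly lt. Qed.

Lemma fps_mulA : associative fps_mul.
Proof.
move=> u v w; apply/funext=> n.
pose T := fps_trunc n.+1; have tE x i : (i < n.+1)%N -> (T x)`_i = x i.
  exact: fps_truncE.
rewrite -(@coef_fps_trunc n.+1 n (T u) (T v * T w)) ?mulrA //; first last.
- by move=> i lti; rewrite (@coef_fps_trunc n.+1 _ _ _ v w) // => k; apply: tE.
- by move=> i; apply: tE.
rewrite (@coef_fps_trunc n.+1 n _ _ (fps_mul u v) w) // => i lti.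
  by rewrite (@coef_fps_trunc n.+1 _ _ _ u v) // => k; apply: tE.
exact: tE.
Qed.

Lemma fps_mulC : commutative fps_mul.
Proof.
move=> u v; apply/funext=> n.
rewrite -(@coef_fps_trunc n.+1 n (fps_trunc n.+1 u) (fps_trunc n.+1 v)) //;
  try by move=> i; apply: fps_truncE.
by rewrite mulrC; apply: (@coef_fps_trunc n.+1) => // i; apply: fps_truncE.
Qed.

Lemma fps_mul1 : left_id fps_one fps_mul.
Proof.
move=> u; apply/funext=> n; rewrite /fps_mul big_ord_recl big1 /=.
  by rewrite addr0 /fps_one mul1r subn0.
by move=> i _; rewrite /fps_one mul0r.
Qed.

Lemma fps_mulDl : left_distributive fps_mul fps_add.
Proof.
move=> u v w; apply/funext=> n; rewrite /fps_mul /fps_add -big_split /=.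
by apply: eq_bigr => i _; rewrite mulrDl.
Qed.

Lemma fps_one_neq0 : fps_one != fps_zero.
Proof.
apply/eqP => /(congr1 (fun u : fps R => u 0%N)) /eqP.
by rewrite /fps_one /fps_zero eqxx oner_eq0.
Qed.

HB.instance Definition _ := GRing.Zmodule_isComNzRing.Build (fps R)
  fps_mulA fps_mulC fps_mul1 fps_mulDl fps_one_neq0.

Lemma fpsD u v n : (u + v) n = u n + v n. Proof. by []. Qed.
Lemma fpsN u n : (- u) n = - u n. Proof. by []. Qed.
Lemma fpsM u v n : (u * v) n = \sum_(k < n.+1) u k * v (n - k)%N.
Proof. by []. Qed.
Lemma fps1 n : (1 : fps R) n = (n == 0%N)%:R. Proof. by []. Qed.

Lemma fps_sum (I : Type) (r : seq I) (P : pred I) (F : I -> fps R) n :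
  (\sum_(i <- r | P i) F i) n = \sum_(i <- r | P i) F i n.
Proof. by elim/big_rec2: _ => // i x y _ <-. Qed.

Definition fpsX : fps R := fun n => (n == 1%N)%:R.
Definition fpsC (a : R) : fps R := fun n => if n is 0%N then a else 0.

Lemma fpsXM u n : (fpsX * u) n = if n is m.+1 then u m else 0.
Proof.
rewrite fpsM; case: n => [|n].
  by rewrite big_ord_recl big_ord0 mul0r addr0.
rewrite big_ord_recl mul0r add0r big_ord_recl big1 => [|i _].
  by rewrite mul1r subn1 addr0.
by rewrite mul0r.
Qed.

Lemma fpsCM a u n : (fpsC a * u) n = a * u n.
Proof.
rewrite fpsM big_ord_recl big1 => [|i _]; first by rewrite subn0 addr0.
by rewrite mul0r.
Qed.

Lemma fps_geometric a : (1 - fpsC a * fpsX) * (fun n => a ^+ n : R) = 1.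
Proof.
apply/funext=> n; rewrite mulrBl mul1r fpsD fpsN -mulrA fpsCM fpsXM fps1.
by case: n => [|n]; rewrite ?mulr0 ?subr0 // -exprS subrr.
Qed.

End PowerSeriesRing.

Arguments fpsX {R}.

(** * Quotients by products of (1-t)^e - s f(t) *)

Notation fps_st := (fps (fps int)).

Definition fps_of_poly (p : {poly {poly int}}) : fps_st := fun n j => p`_n`_j.

Lemma fps_of_poly_is_additive : additive fps_of_poly.
Proof.
by move=> p q; apply/funext=> n; apply/funext=> j; rewrite /fps_of_poly !coefB.
Qed.
HB.instance Definition _ :=
  GRing.isZmodMorphism.Build _ _ fps_of_poly fps_of_poly_is_additive.

Lemma fps_of_poly_is_monoid_morphism : monoid_morphism fps_of_poly.
Proof.
split.
  apply/funext=> n; apply/funext=> j; rewrite /fps_of_poly coef1 fps1.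
  by case: n => [|n] /=; rewrite ?coef1 ?coef0.
move=> p q; apply/funext=> n; apply/funext=> j.
rewrite /fps_of_poly coefM coef_sum fpsM fps_sum; apply: eq_bigr => k _.
by rewrite coefM.
Qed.
HB.instance Definition _ :=
  GRing.isMonoidMorphism.Build _ _ fps_of_poly fps_of_poly_is_monoid_morphism.

Notation fps_t := (fps_of_poly ('X)%:P).
Notation fps_s := (fps_of_poly 'X).

Lemma s_coef (u : fps_st) n : (fps_s * u) n = if n is m.+1 then u m else 0.
Proof.
rewrite -fpsXM; congr ((_ * u) n); apply/funext=> i; apply/funext=> j.
by rewrite /fps_of_poly coefX /fpsX; case: eqP => _; rewrite ?coef1 ?coef0.
Qed.

Lemma fps_of_polyC (p : {poly int}) :
  fps_of_poly p%:P = fpsC ((fun j => p`_j) : fps int).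
Proof.
by apply/funext=> -[|n]; apply/funext=> j; rewrite /fps_of_poly coefC //= coef0.
Qed.

Lemma t_coef (u : fps_st) n j : (fps_t * u) n j = if j is i.+1 then u n i else 0.
Proof.
rewrite fps_of_polyC fpsCM -fpsXM; congr ((_ * u n) j).
by apply/funext=> i; rewrite coefX /fpsX; case: eqP.
Qed.

Lemma fpsM00 (u v : fps_st) : (u * v) 0%N 0%N = u 0%N 0%N * v 0%N 0%N.
Proof. by rewrite fpsM big_ord1 fpsM big_ord1. Qed.

Lemma one_sub_t : 1 - fps_t = fps_of_poly (1 - 'X)%:P.
Proof. by rewrite polyCB rmorphB /= rmorph1. Qed.

Definition den_factor (x : nat * {poly int}) : {poly {poly int}} :=
  ((1 - 'X) ^+ x.1)%:P - 'X * (x.2)%:P.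

Definition admissible (x : nat * {poly int}) : bool :=
  (0 < x.2.[1]) && (x.2.[0] == 1).

(** The denominator is a factor on the left instead of being inverted on the
    right, so that the closure properties below are polynomial identities. *)
Definition rational_form (G : fps_st) : Prop :=
  exists a l g, all admissible l /\
    fps_of_poly (((1 - 'X) ^+ a)%:P * \prod_(x <- l) den_factor x) * G =
    fps_of_poly g.

Lemma rational_form_poly g : rational_form (fps_of_poly g).
Proof. by exists 0%N, [::], g; split; rewrite // big_nil mulr1 rmorph1 mul1r. Qed.

Lemma rational_formD G H :
  rational_form G -> rational_form H -> rational_form (G + H).
Proof.
move=> [a [l [g [lP Gg]]]] [b [m [h [mP Hh]]]].
exists (a + b)%N, (l ++ m).
exists (((1 - 'X) ^+ b)%:P * \prod_(x <- m) den_factor x * g +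
        ((1 - 'X) ^+ a)%:P * \prod_(x <- l) den_factor x * h).
split; first by rewrite all_cat lP.
rewrite rmorphD /= !(rmorphM _ _ g) !(rmorphM _ _ h) /= -Gg -Hh.
rewrite big_cat exprD polyCM !rmorphM /=; ring.
Qed.

Lemma rational_formMpoly p G : rational_form G -> rational_form (fps_of_poly p * G).
Proof.
move=> [a [l [g [lP Gg]]]]; exists a, l, (p * g); split=> //.
by rewrite mulrCA Gg rmorphM.
Qed.

Lemma rational_form_div_1t G : rational_form ((1 - fps_t) * G) -> rational_form G.
Proof.
move=> [a [l [g [lP Gg]]]]; exists a.+1, l, g; split=> //.
by rewrite -Gg one_sub_t exprSr polyCM !rmorphM /=; ring.
Qed.

Lemma rational_form_div_factor x G : admissible x ->
  rational_form (fps_of_poly (den_factor x) * G) -> rational_form G.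
Proof.
move=> xP [a [l [g [lP Gg]]]]; exists a, (x :: l), g; split=> /=; rewrite ?xP //.
by rewrite -Gg big_cons !rmorphM /=; ring.
Qed.

Lemma rational_form_sum (I : Type) (r : seq I) (F : I -> fps_st) :
  (forall i, rational_form (F i)) -> rational_form (\sum_(i <- r) F i).
Proof.
move=> FP; elim/big_rec: _ => [|i G _ GP]; last exact: rational_formD.
by rewrite -(rmorph0 fps_of_poly); apply: rational_form_poly.
Qed.

(** Series [h(t) = p(t) / (1-t)^e] with [p(1) > 0], such as the Hilbert series
    of a nonempty monomial order ideal. Positivity of [p(1)] is the reason why
    such fractions can be added without cancelling the pole. *)
Definition positive_pole (h : fps_st) : Prop :=
  exists e (p : {poly int}),
    0 < p.[1] /\ fps_of_poly ((1 - 'X) ^+ e)%:P * h = fps_of_poly p%:P.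

Lemma positive_pole1 : positive_pole 1.
Proof.
by exists 0%N, 1; rewrite hornerC; split; rewrite // expr0 rmorph1 mulr1.
Qed.

(** Over the larger of the two powers of [1-t] the numerators add up, one of
    them multiplied by a power of [1-t] whose value at 1 is 0 or 1. *)
Lemma positive_poleD h k :
  positive_pole h -> positive_pole k -> positive_pole (h + k).
Proof.
wlog suff base : h k / forall e d p q, (d <= e)%N ->
    0 < p.[1] -> 0 < q.[1] ->
    fps_of_poly ((1 - 'X) ^+ e)%:P * h = fps_of_poly p%:P ->
    fps_of_poly ((1 - 'X) ^+ d)%:P * k = fps_of_poly q%:P ->
    positive_pole (h + k).
  move=> [e [p [p1 hp]]] [d [q [q1 kq]]].
  have [le|lt] := leqP d e; first exact: (base _ _ e d p q).
  by rewrite addrC; apply: (base _ _ d e q p) => //; apply: ltnW.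
move=> e d p q le p1 q1 hp kq.
exists e, (p + (1 - 'X) ^+ (e - d) * q); split.
  rewrite hornerD hornerM horner_exp !hornerE subrr.
  by rewrite ltr_pwDl // mulr_ge0 ?exprn_ge0 // ltW.
rewrite mulrDr hp polyCD polyCM rmorphD rmorphM /= -kq mulrA -rmorphM /= -polyCM.
by rewrite -exprD subnK.
Qed.

Lemma positive_poleMt h : positive_pole h -> positive_pole (fps_t * h).
Proof.
move=> [e [p [p1 hp]]]; exists e, ('X * p); split; first by rewrite !hornerE.
by rewrite mulrCA hp polyCM rmorphM.
Qed.

Lemma positive_pole_div_1t h : positive_pole ((1 - fps_t) * h) -> positive_pole h.
Proof.
move=> [e [p [p1 hp]]]; exists e.+1, p; split=> //.
by rewrite -hp one_sub_t mulrA exprSr polyCM rmorphM.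
Qed.

Lemma fpsC_mul (R : comNzRingType) (a b : R) : fpsC a * fpsC b = fpsC (a * b).
Proof. by apply/funext=> n; rewrite fpsCM; case: n => // n; rewrite mulr0. Qed.

Lemma fpsC_exp (R : comNzRingType) (a : R) n : fpsC a ^+ n = fpsC (a ^+ n).
Proof.
elim: n => [|n IHn]; last by rewrite !exprS IHn fpsC_mul.
by apply/funext=> -[].
Qed.

Lemma inv_1t : exists w : fps int, (1 - fps_t) * fpsC w = 1.
Proof.
pose w : fps int := fun n => 1 ^+ n; have Hw := fps_geometric (1 : int).
exists w; rewrite one_sub_t fps_of_polyC fpsC_mul.
suff -> : ((fun j => (1 - 'X)`_j) : fps int) * w = 1 by apply/funext=> -[].
rewrite -Hw; congr (_ * _).
apply/funext=> j; rewrite coefB coef1 coefX fpsD fpsN fpsCM mul1r fps1 /fpsX.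
by case: j => [|[|j]].
Qed.

(** The factor is [(1-t)^e] times [1 - s f/(1-t)^e], whose inverse is a geometric
    series in [s]. *)
Lemma den_factor_unit x : exists v, fps_of_poly (den_factor x) * v = 1.
Proof.
have [w wE] := inv_1t.
pose a := ((fun j => (x.2)`_j) : fps int) * w ^+ x.1.
have aE : fpsC a = fps_of_poly (x.2)%:P * fpsC w ^+ x.1.
  by rewrite fps_of_polyC fpsC_exp fpsC_mul.
have tE : fps_of_poly ((1 - 'X) ^+ x.1)%:P * fpsC w ^+ x.1 = 1.
  by rewrite polyC_exp rmorphXn /= -one_sub_t -exprMn wE expr1n.
have XE : fps_s = fpsX :> fps_st.
  apply/funext=> n; apply/funext=> j.
  by rewrite /fps_of_poly coefX /fpsX; case: eqP => _; rewrite ?coef1 ?coef0.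
exists (fpsC w ^+ x.1 * ((fun n => a ^+ n) : fps_st)).
rewrite -(fps_geometric a) mulrA; congr (_ * _).
by rewrite /den_factor rmorphB rmorphM /= mulrBl tE aE XE; ring.
Qed.

Lemma rational_form_denominator_unit a l :
  exists v,
    fps_of_poly (((1 - 'X) ^+ a)%:P * \prod_(x <- l) den_factor x) * v = 1.
Proof.
have [w wE] := inv_1t.
elim: l => [|x l [v vE]].
  exists (fpsC w ^+ a); rewrite big_nil mulr1 polyC_exp rmorphXn /= -one_sub_t.
  by rewrite -exprMn wE expr1n.
have [u uE] := den_factor_unit x; exists (u * v).
by rewrite big_cons [X in fps_of_poly X]mulrCA rmorphM mulrACA uE vE mul1r.
Qed.

(** * Well-quasi-orders *)

(** Asking for an infinite increasing subsequence, and not only for one pair of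
    increasing terms, makes the notion stable under products; the two forms are
    equivalent for a transitive relation. *)
Definition wqo_on (T : Type) (P : T -> Prop) (le : T -> T -> Prop) : Prop :=
  forall f : nat -> T, (forall i, P (f i)) ->
    exists2 g : nat -> nat, {homo g : i j / (i < j)%N} &
      forall i j, (i < j)%N -> le (f (g i)) (f (g j)).

(** Ramsey's argument: past some point every index has a later index above it,
    since the indices without one would form a sequence without good pair. *)
Lemma good_pair_wqo (T : Type) (P : T -> Prop) (le : T -> T -> Prop) :
  (forall x y z, le x y -> le y z -> le x z) ->
  (forall f : nat -> T, (forall i, P (f i)) ->
     exists i j, (i < j)%N /\ le (f i) (f j)) ->
  wqo_on P le.
Proof.
move=> le_tr good f fP.
have [N NP] : exists N, forall i, (N <= i)%N ->
    exists j, (i < j)%N /\ le (f i) (f j).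
  apply: contrapT => noN.
  have /choice [h hP] : forall N, exists i, (N <= i)%N /\
      forall j, (i < j)%N -> ~ le (f i) (f j).
    move=> N; apply: contrapT => noi; apply: noN; exists N => i leNi.
    apply: contrapT => noj; apply: noi; exists i; split=> // j ltij leij.
    by apply: noj; exists j.
  pose g := fix g n := if n is m.+1 then h (g m).+1 else h 0%N.
  have g_mono : {homo g : i j / (i < j)%N}.
    apply: homo_ltn; first by move=> y x z; apply: ltn_trans.
    by move=> n /=; have [] := hP (g n).+1.
  have [i [j [ltij]]] := good (f \o g) (fun i => fP (g i)).
  have terminal : forall j, (g i < j)%N -> ~ le (f (g i)) (f j).
    by case: (i) => [|n]; [have [] := hP 0%N | have [] := hP (g n).+1].
  exact: terminal (g_mono _ _ ltij).
have /choice [h hP] : forall i, exists j, (N <= i)%N ->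
    (i < j)%N /\ le (f i) (f j).
  move=> i; case: (leqP N i) => [/NP[j jP]|_]; first by exists j.
  by exists 0%N.
pose g n := iter n h N.
have gN n : (N <= g n)%N.
  elim: n => //= n IHn; have [lt _] := hP _ IHn.
  exact: leq_trans IHn (ltnW lt).
exists g.
  apply: homo_ltn; first by move=> y x z; apply: ltn_trans.
  by move=> n; have [] := hP _ (gN n).
apply: (homo_ltn (r := fun i j => le (f i) (f j))).
  by move=> y x z; apply: le_tr.
by move=> n; have [] := hP _ (gN n).
Qed.

(** Extract a subsequence for the first coordinate, then one for the second. *)
Lemma wqo_prod (T U : Type) (P : T -> Prop) (Q : U -> Prop) leT leU :
  wqo_on P leT -> wqo_on Q leU ->
  wqo_on (fun x => P x.1 /\ Q x.2) (fun x y => leT x.1 y.1 /\ leU x.2 y.2).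
Proof.
move=> wT wU f fP.
have [g g_mono gT] := wT (fst \o f) (fun i => proj1 (fP i)).
have [h h_mono hU] := wU (snd \o f \o g) (fun i => proj2 (fP (g i))).
exists (g \o h) => [i j ltij|i j ltij] /=; first exact/g_mono/h_mono.
by split; [apply: gT; apply: h_mono | apply: hU].
Qed.

Lemma wqo_map (T U : Type) (P : T -> Prop) (Q : U -> Prop) leT leU (h : T -> U) :
  (forall x, P x -> Q (h x)) ->
  (forall x y, P x -> P y -> leU (h x) (h y) -> leT x y) ->
  wqo_on Q leU -> wqo_on P leT.
Proof.
move=> hPQ hle wU f fP; have [g g_mono gU] := wU (h \o f) (fun i => hPQ _ (fP i)).
by exists g => // i j ltij; apply: hle => //; apply: gU.
Qed.

Lemma wqo_nat : wqo_on (fun=> True) leq.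
Proof.
apply: good_pair_wqo => [x y z|f _]; first exact: leq_trans.
apply: contrapT => bad.
have dec i : (f i + i <= f 0)%N.
  elim: i => [|i IHi]; first by rewrite addn0.
  rewrite addnS; apply: leq_trans IHi; rewrite -addSn leq_add2r ltnNge.
  by apply/negP => le; apply: bad; exists i, i.+1.
by have := dec (f 0%N).+1; rewrite addnS ltnNge leq_addl.
Qed.

(** Among three booleans two agree. *)
Lemma wqo_bool : wqo_on (fun=> True) (@eq bool).
Proof.
apply: good_pair_wqo => [x y z -> //|f _].
have [e|] := eqVneq (f 0%N) (f 1%N); first by exists 0%N, 1%N.
have [e _|] := eqVneq (f 0%N) (f 2%N); first by exists 0%N, 2%N.
have [e _ _|] := eqVneq (f 1%N) (f 2%N); first by exists 1%N, 2%N.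
by case: (f 0%N) (f 1%N) (f 2%N) => [] [] [].
Qed.

(** In a sequence that never becomes stationary, pick elements one after
    the other, each after the previous one has been lost: by lowerness an earlier
    one is never below a later one. *)
Lemma wqo_stationary (T : Type) (P : T -> Prop) (le : T -> T -> Prop)
    (X : nat -> T -> Prop) :
  wqo_on P le -> (forall n x, X n x -> P x) ->
  (forall n x y, P x -> le x y -> X n y -> X n x) ->
  (forall n x, X n.+1 x -> X n x) ->
  exists N, forall n x, (N <= n)%N -> X N x -> X n x.
Proof.
move=> wP XP Xlow Xdesc; apply: contrapT => noN.
have desc m n x : (m <= n)%N -> X n x -> X m x.
  by move/subnK => <-; elim: (n - m)%N => //= k IHk /Xdesc.
have /choice [h hP] : forall N, exists nx : nat * T,
    [/\ (N < nx.1)%N, X N nx.2 & ~ X nx.1 nx.2].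
  move=> N; apply: contrapT => nox; apply: noN; exists N => n x leNn XNx.
  apply: contrapT => Xnx; apply: nox; exists (n, x); split=> //=.
  by rewrite ltn_neqAle leNn andbT; apply/eqP => e; rewrite -e in Xnx.
pose k n := iter n (fun m => (h m).1) 0%N.
have k_mono : {homo k : i j / (i < j)%N}.
  apply: homo_ltn; first by move=> y x z; apply: ltn_trans.
  by move=> n; have [] := hP (k n).
have [|g g_mono gle] := wP (fun n => (h (k n)).2).
  by move=> n; have [_ + _] := hP (k n); apply: XP.
have lt01 := g_mono 0%N 1%N isT.
have [_ X0 nX] := hP (k (g 0%N)); have [_ X1 _] := hP (k (g 1%N)).
apply: nX; apply: Xlow (gle 0%N 1%N isT) _; first exact: XP X0.
apply: desc X1; rewrite -[(h _).1]/(k (g 0%N).+1).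
by move: lt01; rewrite leq_eqVlt => /orP[/eqP->//|/k_mono/ltnW].
Qed.

(** * Words and Higman's lemma *)

(** A monomial of an OI-module in width [n] is a word of [n] letters, one per
    column: the letter holds the exponents of the [c] variables of its column,
    and its mark tells whether the column is in the image of the OI-morphism
    applied to the generator. *)
Notation letter := (bool * seq nat)%type.
Notation word := (seq letter).

Definition le_exp (a b : seq nat) : bool := all2 leq a b.

Lemma le_exp_refl : reflexive le_exp.
Proof. by elim=> //= x a IHa; rewrite leqnn. Qed.

Lemma le_exp_trans : transitive le_exp.
Proof.
elim=> [|y b IHb] [|x a] [|z d] //= /andP[xy ab] /andP[yz bd].
by rewrite (leq_trans xy yz); apply: IHb bd.
Qed.

Lemma size_le_exp a b : le_exp a b -> size a = size b.
Proof. by elim: a b => [|x a IHa] [|y b] //= /andP[_ /IHa ->]. Qed.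

Lemma le_exp_nseq0 a : le_exp (nseq (size a) 0%N) a.
Proof. by elim: a. Qed.

(** Dickson's lemma, by induction on the number of coordinates. *)
Lemma wqo_exp k : wqo_on (fun a : seq nat => size a = k) le_exp.
Proof.
elim: k => [|k IHk].
  move=> f fP; exists id => // i j _.
  by move: (fP i) (fP j); case: (f i) (f j) => [] // [].
apply: (wqo_map (h := fun a => (head 0%N a, behead a)) _ _
         (wqo_prod wqo_nat IHk)).
  by move=> [|x a] //= [] ->.
by move=> [|x a] [|y b] //= _ _ [-> ->].
Qed.

(** The divisibility order of monomials of an OI-module: columns outside the
    image of the OI-morphism may be inserted anywhere, marked ones may not. *)
Inductive emb : word -> word -> Prop :=
| emb_nil : emb [::] [::]
| emb_cons l l' u v :
    l.1 = l'.1 -> le_exp l.2 l'.2 -> emb u v -> emb (l :: u) (l' :: v)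
| emb_skip a u v : emb u v -> emb u ((false, a) :: v).

Lemma emb_refl u : emb u u.
Proof. by elim: u => [|l u IHu]; constructor=> //; apply: le_exp_refl. Qed.

Lemma emb_trans u v w : emb u v -> emb v w -> emb u w.
Proof.
move=> uv vw; elim: vw u uv => [u uv|l l' v' w' ll' le _ IHw u uv|a v' w' _ IHw u uv].
- by [].
- inversion uv as [|l0 l1 u0 v0 e1 le1 emb1|a0 u0 v0 emb1]; subst.
    apply: emb_cons (IHw _ emb1); first exact: etrans ll'.
    exact: le_exp_trans le.
  by case: l' ll' le => _ b /= <- _; apply: emb_skip; apply: IHw.
- by apply: emb_skip; apply: IHw.
Qed.

Notation columns c := (all (fun l : letter => size l.2 == c)).

(** Words with different numbers of marks are incomparable, so the divisibility
    order is a well-quasi-order only when that number is bounded. *)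
Definition well_formed (c m : nat) (u : word) : Prop :=
  columns c u /\ count fst u = m.

(** Nash-Williams' argument: the terms are chosen one after the other, each of
    least size among all continuations of the previous choices to a bad sequence.
    The witness is the diagonal of the bad sequences obtained on the way, where
    each agrees with the next one up to its index. *)
Lemma minimal_bad_sequence (T : Type) (P : T -> Prop) (le : T -> T -> Prop)
    (size : T -> nat) (f0 : nat -> T) :
  let bad f := (forall i, P (f i)) /\
    forall i j, (i < j)%N -> ~ le (f i) (f j) in
  bad f0 -> exists2 g, bad g & forall f n, bad f ->
    (forall i, (i < n)%N -> f i = g i) -> (size (g n) <= size (f n))%N.
Proof.
move=> bad bad0.
have /choice [next nextP] : forall x : (nat -> T) * nat, exists f, bad x.1 ->
    [/\ bad f, forall i, (i < x.2)%N -> f i = x.1 i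
      & forall f', bad f' -> (forall i, (i < x.2)%N -> f' i = x.1 i) ->
          (size (f x.2) <= size (f' x.2))%N].
  move=> [f n] /=; have [badf|] := pselect (bad f); last by exists f.
  pose Q k := `[< exists f', [/\ bad f', forall i, (i < n)%N -> f' i = f i
                               & size (f' n) = k] >].
  have exQ : exists k, Q k by exists (size (f n)); apply/asboolP; exists f.
  case: (ex_minnP exQ) => k /asboolP[f' [bad' agree <-]] kmin.
  exists f' => _; split=> // f'' bad'' agree''.
  by apply: kmin; apply/asboolP; exists f''.
pose F := fix F n := if n is m.+1 then next (F m, m.+1) else next (f0, 0%N).
have badF n : bad (F n).
  by elim: n => [|n IHn] /=; [case: (nextP (f0, 0%N)) | case: (nextP (F n, n.+1))].
have agree i n : (i <= n)%N -> F n i = F i i.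
  move/subnK=> <-; elim: (n - i)%N => //= k <-.
  have [_ agree _] := nextP (F (k + i)%N, (k + i).+1) (badF _).
  by apply: agree; rewrite /= ltnS leq_addl.
exists (fun n => F n n).
  split=> [n|i j ltij]; first by have [] := badF n.
  by rewrite -(agree _ _ (ltnW ltij)); have [_] := badF j; apply.
move=> f [|n] badf fF; first by have [_ _] := nextP (f0, 0%N) bad0; apply.
have [_ _] := nextP (F n, n.+1) (badF n); apply=> // i ltin.
by rewrite /= agree ?fF.
Qed.

(** Higman's lemma. In a minimal bad sequence pass to a subsequence whose first
    letters increase. If these are unmarked, replacing the subsequence by its
    tails gives a smaller bad sequence; if they are marked, the tails have fewer
    marks. *)
Theorem wqo_words c m : wqo_on (well_formed c m) emb.
Proof.
elim/ltn_ind: m => m IHm; apply: good_pair_wqo => [|f0 f0P]; first exact: emb_trans.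
apply: contrapT => bad0.
have [|g [gP gbad] gmin] := @minimal_bad_sequence _ _ emb size f0 (conj f0P _).
  by move=> i j ltij le; apply: bad0; exists i, j.
have g_cons i : exists l u, g i = l :: u.
  case E: (g i) => [|l u]; last by exists l, u.
  have embl v : well_formed c m [::] -> well_formed c m v -> emb [::] v.
    move=> [_ <-] [_ /eqP]; elim: v => [|[b a] v IHv] //=; first by constructor.
    by case: b => //= /IHv; apply: emb_skip.
  have gn := gP i; rewrite E in gn.
  by case: (gbad i i.+1 (leqnn _)); rewrite E; apply: embl (gP _).
pose hd i := head (false, [::]) (g i); pose tl i := behead (g i).
have gE i : g i = hd i :: tl i by have [l [u E]] := g_cons i; rewrite /hd /tl E.
have hdP i : True /\ size (hd i).2 = c.
  by split=> //; have [] := gP i; rewrite gE /= => /andP[/eqP].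
have [k k_mono kle] := wqo_prod wqo_bool (@wqo_exp c) hdP.
have emb_tl i j : (i < j)%N -> ~ emb (tl (k i)) (tl (k j)).
  move=> ltij le; apply: (gbad (k i) (k j)); first exact: k_mono.
  by rewrite !gE; case: (kle i j ltij) => ? ?; apply: emb_cons.
have tlP i : columns c (tl (k i)).
  by have [] := gP (k i); rewrite gE /= => /andP[].
have tl_marks i : ((hd (k 0%N)).1 + count fst (tl (k i)))%N = m.
  have [_ <-] := gP (k i); rewrite gE /=; congr (nat_of_bool _ + _)%N.
  by case: i => // i; have [] := kle 0%N i.+1 isT.
case hd0: (hd (k 0%N)).1 in tl_marks.
  have ltm : (m.-1 < m)%N by have := tl_marks 0%N; rewrite add1n => <-.
  have [|h h_mono hle] := IHm _ ltm (fun i => tl (k i)).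
    by move=> i; split; rewrite // -(tl_marks i).
  exact: emb_tl (h_mono 0%N 1%N isT) (hle 0%N 1%N isT).
(* the smaller bad sequence: keep the terms before [n], then use the tails *)
pose n := k 0%N.
pose f i := if (i < n)%N then g i else tl (k (i - n)%N).
have emb_f i j : emb (g i) (tl (k j)) -> emb (g i) (g (k j)).
  have : (hd (k j)).1 = false.
    by rewrite -hd0; case: j => // j; have [] := kle 0%N j.+1 isT.
  by rewrite [g (k j)]gE; case: (hd (k j)) => [b a] /= -> le; apply: emb_skip.
suff fbad : (forall i, well_formed c m (f i)) /\
    forall i j, (i < j)%N -> ~ emb (f i) (f j).
  have : (size (g n) <= size (f n))%N by apply: gmin fbad _ => i; rewrite /f => ->.
  by rewrite /f ltnn subnn gE ltnn.
split=> [i|i j ltij]; rewrite /f.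
  by case: ifP => // _; split; rewrite // -(tl_marks (i - n)%N).
case: ifP => [ltin|/negbT]; case: ifP => [ltjn|/negbT]; rewrite -?leqNgt.
- exact: gbad.
- move=> lenj /emb_f; apply: gbad; apply: leq_trans ltin _.
  case: (j - n)%N => // d; exact: ltnW (k_mono 0%N d.+1 isT).
- by move=> leni; have := leq_trans leni (ltnW ltij); rewrite leqNgt ltjn.
- move=> lenj leni; apply: emb_tl; exact: ltn_sub2r (leq_ltn_trans leni ltij) ltij.
Qed.

(** * Generating functions of lower languages *)

Definition incr_head (a : seq nat) : seq nat :=
  if a is x :: b then x.+1 :: b else [::].

(** Splitting off the vectors with first entry 0 makes the recursion match
    division of generating functions by [1-t]. *)
Fixpoint expos (k : nat) : nat -> seq (seq nat) :=
  if k is k'.+1 then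
    fix aux j := [seq 0%N :: a | a <- expos k' j] ++
                 (if j is i.+1 then [seq incr_head a | a <- aux i] else [::])
  else fun j => if j is 0 then [:: [::]] else [::].

Lemma exposS k j : expos k.+1 j = [seq 0%N :: a | a <- expos k j] ++
  (if j is i.+1 then [seq incr_head a | a <- expos k.+1 i] else [::]).
Proof. by case: j. Qed.

Arguments expos : simpl never.

Lemma mem_expos k j a : (a \in expos k j) = (size a == k) && (sumn a == j).
Proof.
elim: k j a => [|k IHk] j a; first by rewrite /expos; case: j a => [|j] [|x a].
elim: j a => [|j IHj] a; rewrite exposS mem_cat.
  rewrite in_nil orbF; case: a => [|x a] /=; first by apply/negP => /mapP[].
  rewrite eqSS addn_eq0 andbCA -IHk; apply/mapP/andP => [[b bP [-> ->]] //|].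
  by move=> [/eqP-> aP]; exists a.
case: a => [|x a]; first by apply/negP => /orP[] /mapP[] // [|y b]; rewrite ?IHj.
case: x => [|x] /=.
  rewrite add0n eqSS -IHk mem_map => [|b d []] //.
  case: (a \in _) => //=; apply/mapP => -[[|y b] //].
rewrite -[RHS]/((size (x :: a) == k.+1) && (sumn (x :: a) == j)) -IHj.
have -> : (x.+1 :: a \in [seq 0%N :: b | b <- expos k j.+1]) = false.
  by apply/mapP => -[].
apply/mapP/idP => [[[|y b] //= bP [-> ->]] //|aP].
by exists (x :: a).
Qed.

Lemma expos_uniq k j : uniq (expos k j).
Proof.
elim: k j => [|k IHk]; first by case.
elim=> [|j IHj]; rewrite exposS cat_uniq map_inj_uniq ?IHk //=;
  try by move=> a b [].
apply/andP; split.
  by apply/hasPn => a /mapP[[|x b] _ ->]; apply/negP => /mapP[].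
rewrite map_inj_in_uniq // => -[|x a] [|y b]; rewrite !mem_expos //=.
by move=> _ _ [-> ->].
Qed.

Definition letters c i : seq letter :=
  [seq (true, a) | a <- expos c i] ++ [seq (false, a) | a <- expos c i].

Fixpoint words (c n j : nat) : seq word :=
  if n is n'.+1 then
    flatten [seq [seq l :: w | l <- letters c i, w <- words c n' (j - i)%N]
            | i <- iota 0 j.+1]
  else if j == 0%N then [:: [::]] else [::].

Definition weight (u : word) : nat := sumn [seq sumn l.2 | l <- u].

Lemma mem_letters c i l :
  (l \in letters c i) = (size l.2 == c) && (sumn l.2 == i).
Proof.
rewrite mem_cat -mem_expos; case: l => -[] a /=.
  rewrite mem_map => [|x y []] //; case: (a \in _) => //=.
  by apply/mapP => -[].
rewrite orbC mem_map => [|x y []] //; case: (a \in _) => //=.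
by apply/mapP => -[].
Qed.

Lemma mem_words c n j u : (u \in words c n j) =
  [&& size u == n, columns c u & weight u == j].
Proof.
elim: n j u => [|n IHn] j u.
  rewrite /=; case: eqP u => [->|/eqP ne] [|l u] //=.
  by rewrite in_nil eq_sym; apply/esym/negbTE.
apply/flatten_mapP/idP => [[i]|].
  rewrite mem_iota add0n ltnS => leij /allpairsP[[l w] /= [lP wP ->]] /=.
  move: lP wP; rewrite mem_letters IHn eqSS => /andP[-> /eqP il].
  by move=> /and3P[-> -> /eqP wE]; rewrite /weight /= -/(weight w) wE il subnKC /=.
case: u => // l u; rewrite eqSS /= => /and3P[un /andP[lc uc] /eqP <-].
rewrite /weight /= -/(weight u).
have lu : sumn l.2 \in iota 0 (sumn l.2 + weight u).+1.
  by rewrite mem_iota ltnS leq_addr.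
exists (sumn l.2) => //.
apply/allpairsP; exists (l, u); split; rewrite //= ?mem_letters ?lc ?eqxx //.
by rewrite IHn un uc addKn eqxx.
Qed.

Lemma words_uniq c n j : uniq (words c n j).
Proof.
elim: n j => [|n IHn] j; first by rewrite /=; case: eqP.
have lettersU i : uniq (letters c i).
  rewrite cat_uniq !map_inj_uniq ?expos_uniq ?andbT //=; try by move=> x y [].
  by apply/hasPn => l /mapP[a _ ->]; apply/negP => /mapP[].
suff rU r : uniq r -> uniq (flatten
    [seq [seq l :: w | l <- letters c i, w <- words c n (j - i)%N] | i <- r]).
  exact: rU (iota_uniq 0 j.+1).
elim: r => //= i r IHr /andP[ir /IHr rU].
rewrite cat_uniq rU andbT; apply/andP; split.
  by apply: allpairs_uniq => // -[x y] [x' y'] _ _ [-> ->].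
apply/hasPn => u /flatten_mapP[i' ir' /allpairsP[[l w] /= [+ _ ->]]].
rewrite mem_letters => /andP[_ /eqP li']; apply/negP => /allpairsP[[l1 w1] /= [+ _ [e _]]].
by rewrite -e mem_letters li' => /andP[_ /eqP ei]; rewrite -ei ir' in ir.
Qed.

Notation language := (word -> bool).

(** The exponent of [s] is the length of a word and that of [t] its weight. *)
Definition gf c (L : language) : fps_st :=
  fun n j => (count L (words c n j))%:R.

(** The infinite sum of the series [t^|a| F(a)] over the exponent vectors [a] of
    length [k], taken coefficientwise. *)
Definition exp_sum k (F : seq nat -> fps_st) : fps_st :=
  fun n j => \sum_(i < j.+1) \sum_(a <- expos k i) F a n (j - i)%N.

Lemma eq_exp_sum k F G : (forall a, size a = k -> F a = G a) ->
  exp_sum k F = exp_sum k G.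
Proof.
move=> FG; apply/funext=> n; apply/funext=> j; apply: eq_bigr => i _.
by apply: eq_big_seq => a; rewrite mem_expos => /andP[/eqP/FG-> _].
Qed.

Lemma exp_sum0 F : exp_sum 0 F = F [::].
Proof.
apply/funext=> n; apply/funext=> j; rewrite /exp_sum big_ord_recl /= big_seq1.
by rewrite subn0 big1 ?addr0 // => i _; rewrite big_nil.
Qed.

(** Exponent vectors with first entry 0, and those obtained from any exponent
    vector by raising the first entry. *)
Lemma exp_sumS k F : exp_sum k.+1 F =
  exp_sum k (F \o cons 0%N) + fps_t * exp_sum k.+1 (F \o incr_head).
Proof.
apply/funext=> n; apply/funext=> j; rewrite !fpsD t_coef /exp_sum.
under eq_bigr do rewrite exposS big_cat big_map /=.
rewrite big_split /=; congr (_ + _); rewrite big_ord_recl big_nil add0r.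
case: j => [|j]; first by rewrite big_ord0.
by apply: eq_bigr => i _; rewrite big_map.
Qed.

Lemma fps_of_poly_bool (b : bool) n j :
  fps_of_poly b%:R n j = [&& b, n == 0%N & j == 0%N]%:R.
Proof.
case: b; last by rewrite rmorph0.
by rewrite rmorph1 fps1; case: n.
Qed.

(** A nonempty word consists of a first letter, which contributes a factor
    [s t^|a|], and a word of a derivative of the language. *)
Lemma gf_rec c (L : language) : gf c L = fps_of_poly (L [::])%:R +
  fps_s * (exp_sum c (fun a => gf c (fun w => L ((true, a) :: w))) +
       exp_sum c (fun a => gf c (fun w => L ((false, a) :: w)))).
Proof.
apply/funext=> n; apply/funext=> j; rewrite !fpsD s_coef fps_of_poly_bool /gf.
case: n => [|n].
  by rewrite addr0; case: j => [|j] /=; rewrite ?andbF // addn0 andbT.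
rewrite andbF add0r !fpsD /exp_sum -big_split.
rewrite -[words c n.+1 j]/(flatten [seq _ | i <- index_iota 0 j.+1]).
rewrite count_flatten sumnE !big_map natr_sum big_mkord.
apply: eq_bigr => i _; rewrite /letters allpairs_cat count_cat natrD.
by rewrite !allpairs_mapl !count_flatten !sumnE !big_map !natr_sum; congr (_ + _);
  apply: eq_bigr => a _; rewrite count_map.
Qed.

(** The standard monomials on one generator of an OI-module, whose width is [m],
    form such a language. *)
Definition lower_language c m (L : language) : Prop :=
  (forall u, L u -> well_formed c m u) /\
  (forall u v, emb u v -> L v -> L u).

(** Noetherian induction: by Higman's lemma lower languages with a fixed number of
    marks satisfy the descending chain condition. *)
Lemma lower_language_ind c m (Q : language -> Prop) :
  (forall L, lower_language c m L ->
     (forall L', lower_language c m L' -> (forall u, L' u -> L u) -> L' <> L ->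
        Q L') -> Q L) ->
  forall L, lower_language c m L -> Q L.
Proof.
move=> step L0 L0low; apply: contrapT => nQ0.
have /choice [next nextP] : forall L, exists L', lower_language c m L -> ~ Q L ->
    [/\ lower_language c m L', forall u, L' u -> L u, L' <> L & ~ Q L'].
  move=> L; apply: contrapT => noL'.
  have [|Llow] := pselect (lower_language c m L); last by apply: noL'; exists L.
  move=> Llow; have [QL|nQL] := pselect (Q L); first by apply: noL'; exists L.
  apply: nQL; apply: step => // L' L'low L'L L'neL; apply: contrapT => nQL'.
  by apply: noL'; exists L'.
pose X n := iter n next L0.
have XP n : lower_language c m (X n) /\ ~ Q (X n).
  by elim: n => //= n [Xlow nQX]; have [] := nextP _ Xlow nQX.
have Xstep n := nextP _ (proj1 (XP n)) (proj2 (XP n)).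
have [|||N NP] := @wqo_stationary _ _ _ (fun n u => X n u) (@wqo_words c m).
- by move=> n u; have [[+ _] _] := XP n; apply.
- by move=> n u v _ uv; have [[_ low] _] := XP n; apply: low uv.
- by move=> n u; have [_ + _ _] := Xstep n; apply.
have [_ sub ne _] := Xstep N; apply: ne; apply/funext => u.
by apply/idP/idP => [|/(NP N.+1 u (leqnSn _))] //; apply: sub.
Qed.

Section ExponentSum.
Variables (c m : nat) (L : language).

(** When reading an exponent vector [a] leads from [L] to the smaller language
    [phi a], the contribution of those [a] that lead back to [L] itself has a
    pole of positive leading coefficient at [t = 1]: they form an order ideal,
    which is empty unless it contains 0. The remaining [phi a] only contribute
    series of rational form. The proof slices along the first exponent; by
    Dickson's and Higman's lemmas the slices stabilise, which produces a factor
    [1/(1-t)]. *)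
Lemma exp_sum_antitone k (phi : seq nat -> language) :
  (forall a, size a = k -> lower_language c m (phi a)) ->
  (forall a b, size a = k -> le_exp a b -> forall u, phi b u -> phi a u) ->
  (forall a u, size a = k -> phi a u -> L u) ->
  (forall a, size a = k -> phi a = L \/ rational_form (gf c (phi a))) ->
  exists h g, [/\ exp_sum k (fun a => gf c (phi a)) = h * gf c L + g,
    rational_form g &
    if `[< phi (nseq k 0%N) = L >] then positive_pole h /\ h 0%N 0%N = 1
    else h = 0].
Proof.
elim: k phi => [|k IHk] phi philow phianti phiL phirat.
  rewrite exp_sum0 /=; case: asboolP => [->|ne].
    exists 1, 0; rewrite mul1r addr0; split=> //.
      by rewrite -(rmorph0 fps_of_poly); apply: rational_form_poly.
    by split=> //; apply: positive_pole1.
  exists 0, (gf c (phi [::])); rewrite mul0r add0r; split=> //.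
  by have [//|] := phirat [::] erefl.
have slice (psi : seq nat -> language) :
    (forall a, size a = k.+1 -> lower_language c m (psi a)) ->
    (forall a b, size a = k.+1 -> le_exp a b -> forall u, psi b u -> psi a u) ->
    (forall a u, size a = k.+1 -> psi a u -> L u) ->
    (forall a, size a = k.+1 -> psi a = L \/ rational_form (gf c (psi a))) ->
    exists h g, [/\ exp_sum k (fun a => gf c (psi (0%N :: a))) = h * gf c L + g,
      rational_form g &
      if `[< psi (nseq k.+1 0%N) = L >] then positive_pole h /\ h 0%N 0%N = 1
      else h = 0].
  move=> low anti sub rat; apply: (IHk (fun a => psi (0%N :: a))) => /=.
  - by move=> a ak; apply: low; rewrite /= ak.
  - by move=> a b ak ab; apply: anti; rewrite /= ?ak.
  - by move=> a u ak; apply: sub; rewrite /= ak.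
  - by move=> a ak; apply: rat; rewrite /= ak.
have [N NP] : exists N, forall i a, (N <= i)%N -> size a = k ->
    phi (i :: a) = phi (N :: a).
  have [|||N NP] := @wqo_stationary _ _ _
      (fun i (x : seq nat * word) => size x.1 = k /\ phi (i :: x.1) x.2)
      (wqo_prod (@wqo_exp k) (@wqo_words c m)).
  - move=> i [a u] /= [ak phiu]; split=> //.
    by apply: (proj1 (philow (i :: a) _)); rewrite /= ?ak.
  - move=> i [a u] [b v] /= [ak _] [ab uv] [bk phiv]; split=> //.
    apply: (phianti _ (i :: b)); rewrite /= ?ak ?leqnn //.
    by apply: (proj2 (philow (i :: b) _)) uv phiv; rewrite /= bk.
  - move=> i [a u] /= [ak phiu]; split=> //; apply: phianti phiu; rewrite /= ?ak //.
    by rewrite leqnSn le_exp_refl.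
  exists N => i a leNi ak; apply/funext=> u; apply/idP/idP => phiu.
    by apply: phianti phiu; rewrite /= ?ak // leNi le_exp_refl.
  by have [] := NP i (a, u) leNi (conj ak phiu).
have size_incr a : size a = k.+1 -> size (incr_head a) = k.+1 by case: a.
elim: N phi philow phianti phiL phirat NP
    => [|N IHN] phi philow phianti phiL phirat NP.
  have [h [g [E grat hP]]] := slice phi philow phianti phiL phirat.
  have [w wE] := inv_1t; set W := fpsC w in wE.
  (* all slices agree, so the sum is that of one slice divided by [1-t] *)
  exists (W * h), (W * g); split.
  - have : (1 - fps_t) * exp_sum k.+1 (fun a => gf c (phi a)) = h * gf c L + g.
      rewrite -E mulrBl mul1r {1}exp_sumS /=.
      rewrite (@eq_exp_sum _ (_ \o incr_head) (fun a => gf c (phi a))) ?addrK //.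
      by case=> // i a [ak] /=; rewrite NP // [in RHS]NP.
    move=> /(congr1 (fun x => W * x)); rewrite mulrA [W * _]mulrC wE mul1r => ->.
    ring.
  - by apply: rational_form_div_1t; rewrite mulrA wE mul1r.
  - case: asboolP hP => [_ [hpole h00]|_ ->]; last by rewrite mulr0.
    split; first by apply: positive_pole_div_1t; rewrite mulrA wE mul1r.
    have /(congr1 (fun x : fps_st => x 0%N 0%N)) := wE.
    rewrite !fpsM00 h00 mulr1 !fpsD !fpsN -[fps_t]mulr1 t_coef.
    by rewrite subr0 !fps1 mul1r.
(* split off the first slice; the others stabilise one step earlier *)
have [h [g [E grat hP]]] := slice phi philow phianti phiL phirat.
have [|||||h' [g' [E' grat' hP']]] := IHN (phi \o incr_head).
- by move=> a ak; apply/philow/size_incr.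
- move=> a b ak ab; apply: phianti; first exact: size_incr.
  by case: a b ab {ak} => [|x a] [|y b].
- by move=> a u ak; apply/phiL/size_incr.
- by move=> a ak; apply/phirat/size_incr.
- by move=> i a leNi ak; apply: NP.
exists (h + fps_t * h'), (g + fps_t * g'); split.
- by rewrite exp_sumS /= E; move: E' => /= E'; rewrite [exp_sum k.+1 _]E'; ring.
- by apply: rational_formD => //; apply: rational_formMpoly.
- case: asboolP hP => [_ [hpole h00]|phi0 ->].
    rewrite !fpsD t_coef h00 addr0; split=> //.
    case: asboolP hP' => [_ [hpole' _]|_ ->]; last by rewrite mulr0 addr0.
    by apply: positive_poleD => //; apply: positive_poleMt.
  case: asboolP hP' => [phi1|_ ->]; last by rewrite mulr0 addr0.
  (* the second slice is contained in the first one, which is not all of [L] *)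
  case: phi0; apply/funext=> u; apply/idP/idP => [|Lu].
    by apply: phiL; rewrite /= size_nseq.
  apply: (phianti _ (1%N :: nseq k 0%N)); rewrite /= ?size_nseq ?le_exp_refl //.
  by move: phi1 => /= ->.
Qed.

End ExponentSum.

Lemma lower_language_derivative c m (L : language) (b : bool) (a : seq nat) :
  lower_language c m L -> lower_language c (m - b) (fun w => L ((b, a) :: w)).
Proof.
move=> [Lwf Llow]; split=> [u /Lwf[/= /andP[_ uc]] <-|u v uv].
  by split; rewrite // addKn.
by apply: Llow; apply: emb_cons uv; rewrite //= le_exp_refl.
Qed.

(** The generating function of a lower language. Reading the first letter gives
    a linear equation between the series of the language and those of its
    derivatives. Reading a marked letter lowers the number of marks, and reading
    an unmarked one yields a sublanguage, which falls under Noetherian induction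
    unless it is the language itself. The latter terms have series [s h(t)] with
    [h = p/(1-t)^e], and solving for the series divides by [1 - s h(t)]. *)
Theorem lower_language_rational c m (L : language) :
  lower_language c m L -> rational_form (gf c L).
Proof.
elim/ltn_ind: m L => m IHm; apply: lower_language_ind => L Llow IHL.
have Lexp b a a' u : le_exp a a' -> L ((b, a') :: u) -> L ((b, a) :: u).
  by move=> le; apply: (proj2 Llow); apply: emb_cons => //; apply: emb_refl.
have derL b a := lower_language_derivative b a Llow.
(* Marked letters: no derivative equals the language of all words, which has
   words with any number of marks, so here the term with a pole vanishes. *)
have [|h' [g' [Em g'rat]]] := @exp_sum_antitone c (m - true) xpredT c
  (fun a w => L ((true, a) :: w)) (fun a _ => derL true a)
  (fun a a' _ le u => @Lexp true a a' u le) (fun _ _ _ _ => isT).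
  move=> a _; right; case: (posnP m) => [m0|lt0m]; last first.
    by apply: IHm (derL true a); rewrite subn1 prednK.
  suff -> : gf c (fun w => L ((true, a) :: w)) = fps_of_poly 0.
    exact: rational_form_poly.
  rewrite rmorph0; apply/funext=> n; apply/funext=> j; rewrite /gf.
  rewrite (@eq_count _ _ pred0) ?count_pred0 // => u; apply/negP.
  by move/(proj1 Llow) => [_]; rewrite m0.
rewrite asboolF => [h'0|]; last first.
  move=> /(congr1 (fun L => L (nseq m.+1 (true, [::])))) /(proj1 Llow) [_] /=.
  by rewrite count_nseq mul1n; lia.
(* Unmarked letters: the derivatives are contained in [L]. *)
have der0 a : lower_language c m (fun w => L ((false, a) :: w)).
  by have := derL false a; rewrite subn0.
have der0_sub a u : L ((false, a) :: u) -> L u.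
  by apply: (proj2 Llow); apply: emb_skip; apply: emb_refl.
have [|h [g [Eu grat]]] := @exp_sum_antitone c m L c
  (fun a w => L ((false, a) :: w)) (fun a _ => der0 a)
  (fun a a' _ le u => @Lexp false a a' u le) (fun a u _ => @der0_sub a u).
  move=> a _.
  have [|ne] := pselect ((fun w => L ((false, a) :: w)) = L); first by left.
  by right; apply: IHL ne => //; apply: der0_sub.
have EG : gf c L = fps_of_poly (L [::])%:R + fps_s * (g' + (h * gf c L + g)).
  by rewrite {1}gf_rec Em Eu h'0 mul0r add0r.
case: asboolP => [_ [[e [p [p1 hp]]] h00]|_ h0]; last first.
  rewrite EG h0 mul0r add0r; apply: rational_formD; first exact: rational_form_poly.
  by apply: rational_formMpoly; apply: rational_formD.
apply: (@rational_form_div_factor (e, p)).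
  rewrite /admissible p1 /=.
  have /(congr1 (fun x : fps_st => x 0%N 0%N)) := hp.
  (* [p(0)] is the constant coefficient of [h], that is, 1 *)
  rewrite fpsM00 h00 mulr1 /fps_of_poly !coefC /= -!horner_coef0 horner_exp !hornerE.
  by rewrite expr1n => <-.
have -> : fps_of_poly (den_factor (e, p)) * gf c L =
    fps_of_poly ((1 - 'X) ^+ e)%:P * (gf c L - fps_s * (h * gf c L)).
  by rewrite /den_factor rmorphB rmorphM /= -hp; ring.
apply: rational_formMpoly.
have -> : gf c L - fps_s * (h * gf c L) =
    fps_of_poly (L [::])%:R + fps_s * (g' + g).
  by rewrite {1}EG; ring.
apply: rational_formD; first exact: rational_form_poly.
by apply: rational_formMpoly; apply: rational_formD.
Qed.

(** * Standard bases of spanning families *)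

Section StandardBasis.
Variables (K : fieldType) (V : lmodType K).
Implicit Types A B : V -> Prop.

Inductive lspan A : V -> Prop :=
| lspan0 : lspan A 0
| lspanS k x q : A x -> lspan A q -> lspan A (k *: x + q).

Lemma lspan_mem A x : A x -> lspan A x.
Proof.
by move=> Ax; rewrite -[x]addr0 -[X in X + _]scale1r; apply: lspanS Ax (lspan0 _).
Qed.

Lemma lspanD A p q : lspan A p -> lspan A q -> lspan A (p + q).
Proof.
by elim=> [|k x r Ax _ IHr] qA; rewrite ?add0r // -addrA; apply: lspanS (IHr qA).
Qed.

Lemma lspanZ A k q : lspan A q -> lspan A (k *: q).
Proof.
elim=> [|l x r Ax _ IHr]; first by rewrite scaler0; apply: lspan0.
by rewrite scalerDr scalerA; apply: lspanS.
Qed.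

Lemma lspan_sum A (I : Type) (r : seq I) (P : pred I) (F : I -> V) :
  (forall i, P i -> lspan A (F i)) -> lspan A (\sum_(i <- r | P i) F i).
Proof. by move=> FA; elim/big_rec: _ => [|i q /FA]; [apply: lspan0|apply: lspanD]. Qed.

Lemma lspan_trans A B q : (forall x, A x -> lspan B x) -> lspan A q -> lspan B q.
Proof.
move=> AB; elim=> [|k x r /AB Bx _ IHr]; first exact: lspan0.
by apply: lspanD IHr; apply: lspanZ.
Qed.

Variables (T : eqType) (le : rel T).
Hypotheses (le_total : total le) (le_trans : transitive le)
  (le_anti : antisymmetric le).
Variables (E : seq T) (v : T -> V).

Definition span_of (P : pred T) : V -> Prop :=
  lspan (fun q => exists2 x, (x \in E) && P x & q = v x).

(** The complement of the leading terms of the linear relations among the vectors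
    of the family. *)
Definition standard (x : T) : bool :=
  `[< ~ span_of (fun y => (y != x) && le y x) (v x) >].

(** Replace the vector of a term that is not standard by smaller ones; this ends
    because [E] is finite. *)
Lemma span_standard q : span_of xpredT q -> span_of standard q.
Proof.
have lexx x : le x x by have /orP[] := le_total x x.
pose rank x := count (le^~ x) E.
have vP n x : (rank x < n)%N -> x \in E -> span_of standard (v x).
  elim: n x => // n IHn x ltn xE.
  have [std|nstd] := boolP (standard x).
    by apply: lspan_mem; exists x; rewrite ?xE.
  move: nstd; rewrite /standard => /asboolPn/contrapT; apply: lspan_trans.
  move=> _ [y /andP[yE /andP[ne lyx]] ->]; apply: IHn => //.
  move: ltn; rewrite ltnS; apply: leq_trans.
  have -> : rank y = count (le^~ y) [seq z <- E | le z x].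
    rewrite /rank count_filter; apply: eq_count => z /=.
    by case lzy: (le z y) => //=; rewrite (le_trans lzy lyx).
  rewrite /rank -[X in (_ < X)%N]size_filter ltn_neqAle count_size andbT -all_count.
  apply/allPn; exists x; first by rewrite mem_filter lexx.
  by apply: contra ne => lxy; apply/eqP/le_anti; rewrite lyx.
apply: lspan_trans => _ [x /andP[xE _] ->]; exact: vP (leqnn _) xE.
Qed.

Lemma standard_spans q : span_of standard q ->
  let B := in_tuple [seq x <- E | standard x] in
  exists k : 'I_(size [seq x <- E | standard x]) -> K,
    q = \sum_i k i *: v (tnth B i).
Proof.
move=> + B; elim=> [|k _ p [x /andP[xE xstd] ->] _ [l ->]].
  by exists (fun=> 0); rewrite big1 // => i _; rewrite scale0r.
have /tnthP[i xi] : x \in B by rewrite mem_filter xstd.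
exists (fun j => (j == i)%:R * k + l j).
rewrite (eq_bigr _ (fun j _ => scalerDl _ _ _)) big_split /=; congr (_ + _).
rewrite (bigD1 i) //= eqxx mul1r -xi big1 ?addr0 // => j /negbTE ->.
by rewrite mul0r scale0r.
Qed.

Lemma standard_independent (uniqE : uniq E) :
  let B := in_tuple [seq x <- E | standard x] in
  forall k : 'I_(size [seq x <- E | standard x]) -> K,
    \sum_i k i *: v (tnth B i) = 0 -> forall i, k i = 0.
Proof.
move=> B k k0 i0; apply/eqP/negPn/negP => nz0.
have lexx x : le x x by have /orP[] := le_total x x.
(* the largest term with a nonzero coefficient is a combination of smaller ones *)
have [i nzi imax] : exists2 i, k i != 0 &
    forall j, k j != 0 -> le (tnth B j) (tnth B i).
  pose ge := fun x y => le y x.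
  have ge_trans : transitive ge by move=> y x z xy yz; apply: le_trans yz xy.
  have ge_total : total ge by move=> x y; apply: le_total.
  have [i nzi imax] := extremumP (P := fun i => k i != 0) (tnth B)
    lexx ge_trans ge_total nz0.
  by exists i.
have iP : tnth B i \in [seq x <- E | standard x] by apply: mem_tnth.
move: iP; rewrite mem_filter => /andP[/asboolP + _]; apply.
have -> : v (tnth B i) = \sum_(j | j != i) (- (k i)^-1 * k j) *: v (tnth B j).
  move: k0; rewrite (bigD1 i) //= => /(congr1 (fun x => (k i)^-1 *: x)).
  rewrite scaler0 scalerDr scalerA mulVf // scale1r => /eqP.
  rewrite addr_eq0 => /eqP ->; rewrite scaler_sumr -sumrN.
  by apply: eq_bigr => j _; rewrite scalerA mulNr scaleNr.
apply: lspan_sum => j ji; have [->|nzj] := eqVneq (k j) 0.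
  by rewrite mulr0 scale0r; apply: lspan0.
apply/lspanZ/lspan_mem; exists (tnth B j) => //.
rewrite imax // andbT; have := mem_tnth j B; rewrite mem_filter => /andP[_ ->] /=.
have /tuple_uniqP Binj : uniq B by rewrite filter_uniq.
by apply: contra ji => /eqP/Binj->.
Qed.

End StandardBasis.

(** The linear map turns an expression of [v x] by smaller terms into one of its
    image. It will be multiplication by a monomial or an OI-morphism. *)
Lemma standard_map (K : fieldType) (V V' : lmodType K) (T : eqType) (le : rel T)
    (E E' : seq T) (v : T -> V) (v' : T -> V') (f : T -> T) (h : V -> V') x :
  (forall k p q, h (k *: p + q) = k *: h p + h q) ->
  (forall y, y \in E -> f y \in E' /\ v' (f y) = h (v y)) ->
  x \in E ->
  (forall y, y \in E -> y != x -> le y x -> (f y != f x) && le (f y) (f x)) ->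
  standard le E' v' (f x) -> standard le E v x.
Proof.
move=> h_lin fE xE f_mono /asboolP std; apply/asboolP => nstd; apply: std.
have h0 : h 0 = 0.
  by have := h_lin (-1) 0 0; rewrite scaler0 addr0 scaleN1r addNr.
have [_ ->] := fE x xE.
elim: nstd => [|k _ q [y /andP[yE /andP[ne lyx]] ->] _ IHq].
  by rewrite h0; apply: lspan0.
have [fyE' fyh] := fE y yE.
by rewrite h_lin -fyh; apply: lspanS IHq; exists (f y); rewrite ?fyE' ?f_mono.
Qed.

(** * Lexicographic order on words *)

Definition add_exp (e a : seq nat) : seq nat :=
  [seq (p.1 + p.2)%N | p <- zip e a].

Lemma size_add_exp e a : size e = size a -> size (add_exp e a) = size a.
Proof. by move=> ea; rewrite size_map size_zip ea minnn. Qed.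

Lemma nth_add_exp e a l : size e = size a ->
  nth 0%N (add_exp e a) l = (nth 0%N e l + nth 0%N a l)%N.
Proof.
by elim: e a l => [|x e IHe] [|y a] [|l] //= [ea]; apply: IHe.
Qed.

Lemma le_exp_add a b : le_exp a b -> exists2 e, size e = size a & b = add_exp e a.
Proof.
elim: a b => [|x a IHa] [|y b] //= => [_|/andP[xy /IHa[e ea ->]]].
  by exists [::].
by exists ((y - x)%N :: e); rewrite /= ?ea // /add_exp /= subnK.
Qed.

Lemma sumn_add_exp e a : size e = size a ->
  sumn (add_exp e a) = (sumn e + sumn a)%N.
Proof.
elim: e a => [|x e IHe] [|y a] //= [ea].
by rewrite -/(add_exp e a) IHe // addnACA.
Qed.

Notation blank c := (false, nseq c 0%N).

Definition raise_letter (e : seq nat) (l : letter) : letter :=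
  (l.1, add_exp e l.2).

(** The effect on words of multiplying by a monomial in the variables of column
    [k]. *)
Definition raise_at k e (u : word) : word :=
  take k u ++ raise_letter e (nth (false, [::]) u k) :: drop k.+1 u.

(** The effect on words of the OI-morphism whose image omits [k]. *)
Definition insert_at c k (u : word) : word := take k u ++ blank c :: drop k u.

Lemma raise_at_cons k e l u :
  raise_at k.+1 e (l :: u) = l :: raise_at k e u.
Proof. by []. Qed.

Lemma insert_at_cons c k l u :
  insert_at c k.+1 (l :: u) = l :: insert_at c k u.
Proof. by []. Qed.

(** Leading terms are taken for this order: letters are compared from the left, by
    mark and then lexicographically by exponents. Inserting a blank letter and
    raising exponents preserve it, as a monomial order should. *)
Definition lex_le (u v : word) : bool :=
  ((u : seqlexi (bool *l seqlexi nat)) <= v)%O.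
Definition lex_lt (u v : word) : bool :=
  ((u : seqlexi (bool *l seqlexi nat)) < v)%O.

Lemma lex_lt_insert c k u v : size u = size v ->
  lex_lt u v -> lex_lt (insert_at c k u) (insert_at c k v).
Proof.
elim: k u v => [|k IHk] [|x u] [|y v] //.
  by rewrite /lex_lt /insert_at /= eqhead_ltxiE.
move=> [uv]; rewrite !insert_at_cons /lex_lt !ltxi_cons => /andP[-> /implyP lt].
by apply/implyP => /lt; apply: IHk.
Qed.

Lemma lexi_lt_add_exp e a b : size e = size a -> size e = size b ->
  ((add_exp e a : seqlexi nat) < add_exp e b)%O = ((a : seqlexi nat) < b)%O.
Proof.
elim: e a b => [|x e IHe] [|y a] [|z b] // [ea] [eb].
by rewrite /add_exp /= -!/(add_exp _ _) !ltxi_cons IHe // !leEnat !leq_add2l.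
Qed.

Lemma lex_lt_raise c k e u v : (k < size u)%N -> size u = size v -> size e = c ->
  columns c u ->
  columns c v ->
  lex_lt u v -> lex_lt (raise_at k e u) (raise_at k e v).
Proof.
move=> + + ec; elim: k u v => [|k IHk] [|x u] [|y v] //= ku [uv] /andP[/eqP xc uc]
    /andP[/eqP yc vc]; last first.
  rewrite !raise_at_cons /lex_lt !ltxi_cons => /andP[-> /implyP lt].
  by apply/implyP => /lt; apply: IHk.
rewrite /raise_at /= !drop0 /lex_lt !ltxi_cons.
have lt_raise l l' : size l.2 = c -> size l'.2 = c ->
    ((raise_letter e l : bool *l seqlexi nat) < raise_letter e l')%O =
    ((l : bool *l seqlexi nat) < l')%O.
  case: l l' => [b a] [b' a'] /= ac a'c.
  by rewrite /raise_letter !ltxi_pair /= lexi_lt_add_exp ?ec.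
have le_raise l l' : size l.2 = c -> size l'.2 = c ->
    ((raise_letter e l : bool *l seqlexi nat) <= raise_letter e l')%O =
    ((l : bool *l seqlexi nat) <= l')%O.
  by move=> lc l'c; rewrite !leNgt lt_raise.
by rewrite !le_raise.
Qed.

(** * Restriction of scalars and OI-morphisms *)

(** An alias carrying the structure of vector space over [K], the original type
    being already a module over the polynomial ring. *)
Definition kspace (K : fieldType) N (V : lmodType {mpoly K[N]}) : Type := V.

Section RestrictionOfScalars.
Variables (K : fieldType) (N : nat) (V : lmodType {mpoly K[N]}).

HB.instance Definition _ := GRing.Zmodule.copy (kspace V) V.

Definition kscale (k : K) (q : kspace V) : kspace V :=
  (k%:MP : {mpoly K[N]}) *: (q : V).

Fact kscaleA a b q : kscale a (kscale b q) = kscale (a * b) q.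
Proof. by rewrite /kscale scalerA -mpolyCM. Qed.
Fact kscale1 : left_id 1 kscale.
Proof. by move=> q; rewrite /kscale mpolyC1 scale1r. Qed.
Fact kscaleDr : right_distributive kscale +%R.
Proof. by move=> a p q; rewrite /kscale -scalerDr. Qed.
Fact kscaleDl q : {morph kscale^~ q : a b / a + b}.
Proof. by move=> a b; rewrite /kscale mpolyCD scalerDl. Qed.

HB.instance Definition _ := GRing.Zmodule_isLmodule.Build K (kspace V)
  kscaleA kscale1 kscaleDr kscaleDl.

Lemma kscaleE (k : K) (q : kspace V) :
  k *: q = (k%:MP : {mpoly K[N]}) *: (q : V) :> V.
Proof. by []. Qed.
End RestrictionOfScalars.

Section OIMorphisms.

Lemma OIhom_ltn m n (e : OIhom m n) (i j : 'I_m) : (i < j)%N -> (e i < e j)%N.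
Proof. by have /forallP/(_ i)/forallP/(_ j)/implyP := svalP e. Qed.

Lemma OIhom_inj m n (e : OIhom m n) : injective e.
Proof.
move=> i j ij; apply: val_inj.
by case: (ltngtP i j) => // /(OIhom_ltn e); rewrite ij ltnn.
Qed.

Lemma OIhomP m n (e e' : OIhom m n) : e =1 e' -> e = e'.
Proof. by move=> ee'; apply/val_inj/ffunP. Qed.

(** An increasing map is the sorted enumeration of its image. *)
Lemma OIhom_eq_codom m n (e e' : OIhom m n) : codom e =i codom e' -> e = e'.
Proof.
move=> ee'; have sortedE (f : OIhom m n) : sorted ltn [seq val k | k <- codom f].
  rewrite -map_comp sorted_map.
  have : sorted ltn [seq val k | k <- enum 'I_m] by rewrite val_enum_ord iota_ltn_sorted.
  by rewrite sorted_map; apply: sub_sorted => i j /(OIhom_ltn f).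
have : [seq val k | k <- codom e] = [seq val k | k <- codom e'].
  apply: (irr_sorted_eq ltn_trans ltnn) => // k.
  by apply/mapP/mapP => -[x xe ->]; exists x => //; rewrite ?ee' // -ee'.
move/(inj_map val_inj) => E; apply: OIhomP => i.
by move: E => /eq_in_map; apply; rewrite mem_enum.
Qed.

Lemma OIhom_of_pred m n (A : pred 'I_n) : #|A| = m ->
  exists e : OIhom m n, forall k, (k \in codom e) = A k.
Proof.
move=> cardA.
have size_A : size (enum A) = m by rewrite -cardE.
pose t : m.-tuple 'I_n := tcast cardA (enum_tuple A).
have tE : t = enum A :> seq _ by rewrite val_tcast.
have incr_t : strictly_increasing [ffun i => tnth t i].
  apply/forallP=> i; apply/forallP=> j; apply/implyP=> ltij; rewrite !ffunE.
  have x0 := tnth t i; rewrite !(tnth_nth x0) tE -!(nth_map _ 0%N val) ?size_A //.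
  apply: (sorted_ltn_nth ltn_trans) => //; rewrite ?inE ?size_map ?size_A //.
  have := iota_ltn_sorted 0 n; rewrite -val_enum_ord.
  move/(subseq_sorted ltn_trans); apply; apply: map_subseq.
  by rewrite enumT /enum_mem; apply: filter_subseq.
exists (exist (fun f => strictly_increasing f) _ incr_t) => k.
transitivity (k \in enum A); last by rewrite mem_enum.
rewrite -tE; apply/codomP/tnthP => -[i ->]; exists i;
by rewrite /OIfun /= ffunE.
Qed.

Fact OIlift_subproof n (k : 'I_n.+1) :
  strictly_increasing [ffun i : 'I_n => lift k i].
Proof.
apply/forallP=> i; apply/forallP=> j; apply/implyP=> ltij; rewrite !ffunE.
by rewrite /= /bump; lia.
Qed.

Definition OIlift n (k : 'I_n.+1) : OIhom n n.+1 :=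
  exist (fun f => strictly_increasing f) _ (OIlift_subproof k).

Lemma OIliftE n (k : 'I_n.+1) i : OIlift k i = lift k i.
Proof. by rewrite /OIfun /= ffunE. Qed.

Lemma OIcompE m n p (e2 : OIhom n p) (e1 : OIhom m n) i :
  OIcomp e2 e1 i = e2 (e1 i).
Proof. by rewrite {1}/OIfun /= ffunE. Qed.

End OIMorphisms.

(** * Monomials and words *)

Definition mark (u : word) (k : nat) : bool := (nth (false, [::]) u k).1.
Definition exponent (u : word) (k l : nat) : nat :=
  nth 0%N (nth (false, [::]) u k).2 l.

Lemma nth_raise_at k e u i : (k < size u)%N ->
  nth (false, [::]) (raise_at k e u) i =
  if i == k then raise_letter e (nth (false, [::]) u k)
  else nth (false, [::]) u i.
Proof.
elim: k u i => [|k IHk] [|l u] [|i] //= ltk; last exact: IHk.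
by rewrite drop0.
Qed.

Lemma nth_insert_at c k u i : (k <= size u)%N ->
  nth (false, [::]) (insert_at c k u) (bump k i) = nth (false, [::]) u i.
Proof.
rewrite /bump; elim: k u i => [|k IHk] [|l u] [|i] //= lek.
by rewrite -[(k < i.+1)%N]/(k <= i)%N addnS; apply: IHk.
Qed.

Lemma nth_insert_at_eq c k u : (k <= size u)%N ->
  nth (false, [::]) (insert_at c k u) k = blank c.
Proof.
by elim: k u => [|k IHk] [|l u] //= lek; apply: IHk.
Qed.

Definition monomial (K : fieldType) c n (u : word) : OIalg K c n :=
  \prod_(k < n) \prod_(l < c) OIvar K l k ^+ exponent u k l.

Lemma monomial_raise (K : fieldType) c n (k : 'I_n) e u : size u = n ->
  columns c u -> size e = c ->
  monomial K c n (raise_at k e u) =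
  (\prod_(l < c) OIvar K l k ^+ nth 0%N e l) * monomial K c n u.
Proof.
move=> un uc ec; have ku : (k < size u)%N by rewrite un.
rewrite /monomial (bigD1 k) //= [in RHS](bigD1 k) //= mulrA; congr (_ * _).
  rewrite -big_split /=; apply: eq_bigr => l _.
  rewrite -exprD /exponent nth_raise_at // eqxx nth_add_exp //.
  by rewrite ec; apply/esym/eqP/(all_nthP (false, [::]) uc).
apply: eq_bigr => i ik; apply: eq_bigr => l _.
by rewrite /exponent nth_raise_at // ifN.
Qed.

Lemma OIpush_monomial_lift (K : fieldType) c n (k : 'I_n.+1) u : size u = n ->
  OIpush (OIlift k) (monomial K c n u) = monomial K c n.+1 (insert_at c k u).
Proof.
move=> un; have ku : (k <= size u)%N by rewrite un -ltnS.
rewrite /monomial (bigD1_ord k) //= [X in X * _]big1 => [|l _]; last first.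
  by rewrite /exponent nth_insert_at_eq // nth_nseq ltn_ord expr0.
rewrite mul1r /OIpush rmorph_prod; apply: eq_bigr => i _.
rewrite rmorph_prod; apply: eq_bigr => l _.
rewrite rmorphXn /= -/(OIpush (OIlift k) (OIvar K l i)) OIpush_var OIliftE /exponent.
by rewrite nth_insert_at.
Qed.

(** The OI-morphism placing a generator is recovered from a word: its image is the
    set of marked positions. *)
Definition matches m n (e : OIhom m n) (u : word) : bool :=
  [forall k : 'I_n, (k \in codom e) == mark u k].

Lemma matchesP m n (e : OIhom m n) u :
  reflect (forall k : 'I_n, (k \in codom e) = mark u k) (matches e u).
Proof. exact: 'forall_eqP. Qed.

Lemma matches_inj m n (e e' : OIhom m n) u :
  matches e u -> matches e' u -> e = e'.
Proof.
move=> /matchesP eu /matchesP e'u; apply: OIhom_eq_codom => k.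
by rewrite eu e'u.
Qed.

Lemma card_mark u : #|[pred k : 'I_(size u) | mark u k]| = count fst u.
Proof. by rewrite -sum1_card -sum1_count (big_nth (false, [::])) big_mkord. Qed.

Lemma matches_exists m n u : size u = n -> count fst u = m ->
  exists e : OIhom m n, matches e u.
Proof.
move=> <- <-; have [e eP] := OIhom_of_pred (card_mark u).
by exists e; apply/matchesP=> k; rewrite eP.
Qed.

Lemma matches_count m n (e : OIhom m n) u : size u = n -> matches e u ->
  count fst u = m.
Proof.
move=> un; case: n / un e => e /matchesP eu; rewrite -card_mark.
rewrite -(eq_card eu) card_codom ?card_ord //; exact: OIhom_inj.
Qed.

Lemma matches_raise m n (e : OIhom m n) k a u : (k < size u)%N ->
  matches e (raise_at k a u) = matches e u.
Proof.
move=> ku; apply: eq_forallb => i; congr (_ == _).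
by rewrite /mark nth_raise_at //; case: eqP => [->|].
Qed.

Lemma matches_insert m n (e : OIhom m n) (k : 'I_n.+1) c u : size u = n ->
  matches e u -> matches (OIcomp (OIlift k) e) (insert_at c k u).
Proof.
move=> un /matchesP eu; have ku : (k <= size u)%N by rewrite un -ltnS.
apply/matchesP=> i; rewrite /mark; case: (unliftP k i) => [j ->|->].
  rewrite nth_insert_at // -/(mark u j) -eu.
  apply/codomP/codomP => -[x xE]; exists x; last by rewrite OIcompE OIliftE xE.
  by apply: (@lift_inj _ k); rewrite xE OIcompE OIliftE.
rewrite nth_insert_at_eq //=; apply/codomP => -[x].
by rewrite OIcompE OIliftE => /eqP; rewrite (negbTE (neq_lift _ _)).
Qed.

Lemma raise_at_cat e pre l u :
  raise_at (size pre) e (pre ++ l :: u) = pre ++ raise_letter e l :: u.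
Proof.
elim: pre => [|l' pre IHpre] /=; first by rewrite /raise_at /= drop0.
by rewrite raise_at_cons IHpre.
Qed.

Lemma insert_at_cat c pre u :
  insert_at c (size pre) (pre ++ u) = pre ++ blank c :: u.
Proof. by rewrite /insert_at take_size_cat // drop_size_cat. Qed.

Lemma weight_cat u v : weight (u ++ v) = (weight u + weight v)%N.
Proof. by rewrite /weight map_cat sumn_cat. Qed.

Lemma weight_cons l u : weight (l :: u) = (sumn l.2 + weight u)%N.
Proof. by []. Qed.

Lemma word_split k (u : word) : (k < size u)%N ->
  exists pre l v, u = pre ++ l :: v /\ size pre = k.
Proof.
move=> ku; exists (take k u), (nth (false, [::]) u k), (drop k.+1 u).
by rewrite -drop_nth // cat_take_drop size_take ku.
Qed.

Lemma raise_at_shape c k e u : (k < size u)%N -> size e = c -> columns c u ->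
  [/\ size (raise_at k e u) = size u, columns c (raise_at k e u),
      count fst (raise_at k e u) = count fst u
    & weight (raise_at k e u) = (sumn e + weight u)%N].
Proof.
move=> /word_split[pre [l [v [-> <-]]]] ec; rewrite raise_at_cat.
rewrite !size_cat !all_cat !count_cat !weight_cat !weight_cons /=.
move=> /and3P[-> /eqP lc ->]; rewrite size_add_exp ?lc // eqxx; split=> //.
by rewrite sumn_add_exp ?lc // -addnA addnCA.
Qed.

Lemma insert_at_shape c k u : (k <= size u)%N -> columns c u ->
  [/\ size (insert_at c k u) = (size u).+1, columns c (insert_at c k u),
      count fst (insert_at c k u) = count fst u
    & weight (insert_at c k u) = weight u].
Proof.
move=> ku; have [pre [v [-> <-]]] : exists pre v, u = pre ++ v /\ size pre = k.
  by exists (take k u), (drop k u); rewrite cat_take_drop size_takel.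
rewrite insert_at_cat !size_cat !all_cat !count_cat !weight_cat !weight_cons /=.
by move=> /andP[-> ->]; rewrite size_nseq eqxx sumn_nseq mul0n addnS.
Qed.

Lemma monomial_homog (K : fieldType) c n u : size u = n -> columns c u ->
  monomial K c n u \is (weight u).-homog.
Proof.
move=> un uc.
have -> : weight u = (\sum_(k < n) \sum_(l < c) exponent u k l)%N.
  rewrite /weight sumnE big_map (big_nth (false, [::])) big_mkord -un.
  apply: eq_bigr => k _; rewrite sumnE (big_nth 0%N) big_mkord.
  by rewrite (eqP (all_nthP _ uc k (ltn_ord k))).
rewrite /monomial; elim/big_rec2: _ => [|k p a _ aP]; first exact: dhomog1.
apply: dhomogM aP; elim/big_rec2: _ => [|l p' a' _ aP]; first exact: dhomog1.
have homX : OIvar K l k \is 1.-homog by rewrite dhomogX /= mdeg1.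
by apply: dhomogM aP; have := dhomogMn (exponent u k l) homX; rewrite mul1n.
Qed.

(** The inverse encoding: the word of the monomial ['X_[a]] times the image of a
    generator under [e]. *)
Definition word_of c m n (e : OIhom m n) (a : 'X_{1..c * n}) : word :=
  [seq (k \in codom e, [seq a (mxvec_index l k) | l <- enum 'I_c])
  | k <- enum 'I_n].

Section WordOf.
Variables (K : fieldType) (c m n : nat) (e : OIhom m n) (a : 'X_{1..c * n}).

Lemma size_word_of : size (word_of e a) = n.
Proof. by rewrite size_map size_enum_ord. Qed.

Lemma nth_word_of (k : 'I_n) : nth (false, [::]) (word_of e a) k =
  (k \in codom e, [seq a (mxvec_index l k) | l <- enum 'I_c]).
Proof. by rewrite (nth_map k) ?size_enum_ord // nth_ord_enum. Qed.

Lemma columns_word_of : columns c (word_of e a).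
Proof. by rewrite all_map; apply/allP => k _ /=; rewrite size_map size_enum_ord. Qed.

Lemma matches_word_of : matches e (word_of e a).
Proof. by apply/matchesP=> k; rewrite /mark nth_word_of. Qed.

Lemma monomial_word_of : monomial K c n (word_of e a) = 'X_[a].
Proof.
rewrite mpolyXE_id (reindex _ (curry_mxvec_bij c n)) /=.
rewrite (eq_bigr (fun x => 'X_(mxvec_index x.1 x.2) ^+ a (mxvec_index x.1 x.2)));
  last by case.
rewrite -(pair_bigA _ (fun l k => 'X_(mxvec_index l k) ^+ a (mxvec_index l k))) /=.
rewrite exchange_big /=; apply: eq_bigr => k _; apply: eq_bigr => l _.
rewrite /exponent nth_word_of /= (nth_map l) ?size_enum_ord //.
by rewrite nth_ord_enum.
Qed.
End WordOf.

(** * Standard monomials of a module with homogeneous generators *)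

Section GeneratedModule.
Variables (K : fieldType) (c : nat) (M : graded_oi_module K c).
Variables (r : nat) (w d : 'I_r -> nat) (y : forall i, M (w i)).
Notation term := ('I_r * word)%type.

(** The vector encoded by a term: a monomial times the image of a generator. When
    no OI-morphism fits the marks the value 0 is a dummy. *)
Definition elt n (x : term) : kspace (M n) :=
  if [pick e : OIhom (w x.1) n | matches e x.2] is Some e
  then monomial K c n x.2 *: oi_map e (y x.1) else 0.

Lemma eltE n i (e : OIhom (w i) n) u : matches e u ->
  elt n (i, u) = monomial K c n u *: oi_map e (y i) :> M n.
Proof.
move=> eu; rewrite /elt; case: pickP => [e' /= e'u|/(_ e)]; last by rewrite /= eu.
by rewrite (matches_inj e'u eu).
Qed.

Definition terms n j : seq term :=
  [seq (i, u) | i <- [seq i <- enum 'I_r | (d i <= j)%N],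
                u <- [seq u <- words c n (j - d i) | count fst u == w i]].

Lemma mem_terms n j x : (x \in terms n j) =
  [&& size x.2 == n, columns c x.2,
      count fst x.2 == w x.1 & (d x.1 + weight x.2 == j)%N].
Proof.
case: x => i u /=; apply/allpairsPdep/idP => [[i' [u' [+ + [-> ->]]]]|].
  rewrite !mem_filter mem_words => /andP[le _] /and4P[-> -> -> /eqP ->].
  by rewrite subnKC ?eqxx.
move=> /and4P[un uc um /eqP <-]; exists i, u; split=> //.
  by rewrite mem_filter leq_addr mem_enum.
by rewrite mem_filter um mem_words un uc addKn eqxx.
Qed.

Lemma terms_uniq n j : uniq (terms n j).
Proof.
apply: allpairs_uniq_dep; first by rewrite filter_uniq ?enum_uniq.
  by move=> i _; rewrite filter_uniq ?words_uniq.
by move=> [i u] [i' u'] _ _ /= [-> ->].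
Qed.

Definition term_le (x x' : term) : bool :=
  (x.1 < x'.1)%N || (x.1 == x'.1) && lex_le x.2 x'.2.

Lemma term_le_total : total term_le.
Proof.
move=> [i u] [i' u']; rewrite /term_le /= [i' == i]eq_sym.
case: (ltngtP i i') => [//|_|/val_inj ->]; first by rewrite orbT.
by rewrite eqxx /= /lex_le le_total.
Qed.

Lemma term_le_trans : transitive term_le.
Proof.
move=> [i u] [i1 u1] [i2 u2]; rewrite /term_le /=.
case/orP=> [lt1|/andP[/eqP-> le1]] /orP[lt2|/andP[/eqP<- le2]];
  rewrite ?lt1 ?lt2 ?(ltn_trans lt1 lt2) // eqxx /=.
by rewrite orbC /lex_le (le_trans le1 le2).
Qed.

Lemma term_le_anti : antisymmetric term_le.
Proof.
move=> [i u] [i1 u1]; rewrite /term_le /= [i1 == i]eq_sym.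
case: (ltngtP i i1) => [lt|lt|/val_inj ->]; rewrite ?eqxx /=.
- by move: lt; case: eqP => [->|]; rewrite ?ltnn.
- by move: lt; case: eqP => [->|]; rewrite ?ltnn.
- by move=> le; congr (_, _); apply: (le_anti (T := seqlexi (bool *l seqlexi nat))).
Qed.

Definition standard_term n j (x : term) : bool :=
  standard term_le (terms n j) (elt n) x.

(** Membership refers to the terms of the width and degree of the word itself, so
    that one language describes the standard monomials on [i] in all widths. *)
Definition standard_words (i : 'I_r) : language := fun u =>
  [&& columns c u, count fst u == w i
    & standard_term (size u) (d i + weight u) (i, u)].

Lemma term_lt_map (f : word -> word) i u i' u' :
  (lex_lt u' u -> lex_lt (f u') (f u)) ->
  (i', u') != (i, u) -> term_le (i', u') (i, u) ->
  ((i', f u') != (i, f u)) && term_le (i', f u') (i, f u).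
Proof.
move=> f_mono; rewrite /term_le /= !xpair_eqE.
case: (ltngtP i' i) => [lt _ _|lt _|/val_inj ->] /=.
- by rewrite andbT negb_and -val_eqE /= ltn_eqF.
- by rewrite -val_eqE /= gtn_eqF.
rewrite eqxx /= => ne le; move: f_mono; rewrite /lex_lt /lex_le !lt_neqAle.
by rewrite ne /=; apply; apply: le.
Qed.

Lemma kspace_scale_comm n (p : OIalg K c n) k (q q' : kspace (M n)) :
  (p *: ((k *: q + q' : kspace (M n)) : M n) : kspace (M n)) =
  k *: (p *: (q : M n) : kspace (M n)) + (p *: (q' : M n) : kspace (M n)).
Proof. by rewrite !kscaleE scalerDr !scalerA mulrC. Qed.

Lemma kspace_oi_map m n (e : OIhom m n) k (q q' : kspace (M m)) :
  (oi_map e (k *: q + q' : kspace (M m)) : kspace (M n)) =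
  k *: (oi_map e q : kspace (M n)) + (oi_map e q' : kspace (M n)).
Proof. by rewrite !kscaleE oi_mapD oi_mapZ /OIpush comp_mpolyC. Qed.

(** A relation expressing a monomial by smaller ones remains one after
    multiplication by a monomial. *)
Lemma standard_words_raise i k e u : (k < size u)%N -> size e = c ->
  columns c u -> standard_words i (raise_at k e u) -> standard_words i u.
Proof.
move=> ku ec uc; have [rs rc rm rw] := raise_at_shape ku ec uc.
rewrite /standard_words rs rc rm rw => /and3P[_ um]; rewrite uc um /=.
pose p : OIalg K c (size u) := \prod_(l < c) OIvar K l (Ordinal ku) ^+ nth 0%N e l.
apply: (@standard_map K (kspace (M (size u))) (kspace (M (size u))) _ _ _ _ _ _
  (fun x => (x.1, raise_at k e x.2)) (fun q => p *: (q : M (size u))) (i, u)).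
- by move=> *; apply: kspace_scale_comm.
- move=> [i' u']; rewrite !mem_terms /= => /and4P[/eqP u'n u'c u'm /eqP u'd].
  have ku' : (k < size u')%N by rewrite u'n.
  have [-> -> -> ->] := raise_at_shape ku' ec u'c.
  rewrite u'n u'm addnCA u'd addnCA !eqxx; split=> //.
  have [e' e'u] := matches_exists u'n (eqP u'm).
  rewrite (eltE e'u) (@eltE _ _ e') ?matches_raise // scalerA.
  by rewrite (@monomial_raise _ _ _ (Ordinal ku)).
- by rewrite mem_terms /= uc um !eqxx.
- move=> [i' u']; rewrite mem_terms /= => /and4P[/eqP u'n u'c _ _].
  apply: (@term_lt_map (raise_at k e)); apply: lex_lt_raise uc => //.
  by rewrite u'n.
Qed.

(** A relation expressing a monomial by smaller ones remains one after applying an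
    OI-morphism. *)
Lemma standard_words_insert i k u : (k <= size u)%N -> columns c u ->
  standard_words i (insert_at c k u) -> standard_words i u.
Proof.
move=> ku uc; have [rs rc rm rw] := insert_at_shape ku uc.
rewrite /standard_words rs rc rm rw => /and3P[_ um]; rewrite uc um /=.
have kn : (k < (size u).+1)%N by [].
apply: (@standard_map K (kspace (M (size u))) (kspace (M (size u).+1)) _ _ _ _ _ _
  (fun x => (x.1, insert_at c k x.2))
  (fun q => oi_map (OIlift (Ordinal kn)) (q : M (size u))) (i, u)).
- by move=> *; apply: kspace_oi_map.
- move=> [i' u']; rewrite !mem_terms /= => /and4P[/eqP u'n u'c u'm u'd].
  have ku' : (k <= size u')%N by rewrite u'n.
  have [-> -> -> ->] := insert_at_shape ku' u'c.
  rewrite u'n u'm u'd !eqxx; split=> //.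
  have [e' e'u] := matches_exists u'n (eqP u'm).
  rewrite (eltE e'u) (eltE (matches_insert (Ordinal kn) c u'n e'u)).
  by rewrite oi_mapZ OIpush_monomial_lift // oi_map_comp.
- by rewrite mem_terms /= uc um !eqxx.
- move=> [i' u']; rewrite mem_terms /= => /and4P[/eqP u'n u'c _ _].
  by apply: (@term_lt_map (insert_at c k)); apply: lex_lt_insert.
Qed.

(** Divisibility is generated by raising exponents and inserting blank letters.
    Since this happens inside a word, the induction carries a common prefix. *)
Lemma standard_words_lower i : lower_language c (w i) (standard_words i).
Proof.
split=> [u /and3P[uc /eqP um _] //|u v uv Lv].
suff L_pre pre : standard_words i (pre ++ v) -> standard_words i (pre ++ u).
  exact: L_pre [::] Lv.
elim: uv pre {Lv} => {u v} [|l l' u v ll' le _ IH|a u v _ IH] pre //.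
  rewrite -cat_rcons => /IH; rewrite cat_rcons => Lu.
  have [e ea l'E] := le_exp_add le.
  have l'r : l' = raise_letter e l by case: l' ll' l'E {le IH Lu} => b x /= <- ->.
  move: (Lu); rewrite l'r -raise_at_cat.
  have /and3P[+ _ _] := Lu; rewrite all_cat /= => /and3P[prec l'c uc].
  rewrite -(size_le_exp le) in l'c.
  apply: standard_words_raise; rewrite ?size_cat /= ?addnS ?ltnS ?leq_addr //.
    by rewrite ea (eqP l'c).
  by rewrite all_cat /= prec l'c.
rewrite -cat_rcons => /IH; rewrite cat_rcons => Lu.
have /and3P[+ _ _] := Lu; rewrite all_cat /= => /and3P[prec ac uc].
have [e ea aE] : exists2 e, size e = size (nseq c 0%N) & a = add_exp e (nseq c 0%N).
  by apply: le_exp_add; rewrite -(eqP ac) le_exp_nseq0.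
rewrite size_nseq in ea.
have blank_c : columns c (pre ++ blank c :: u).
  by rewrite all_cat /= prec size_nseq eqxx.
apply: (@standard_words_insert i (size pre)); rewrite ?size_cat ?leq_addr //.
  by rewrite all_cat prec.
rewrite insert_at_cat.
apply: (@standard_words_raise i (size pre) e) => //.
  by rewrite size_cat /= addnS ltnS leq_addr.
by rewrite raise_at_cat /raise_letter /= -aE.
Qed.

Lemma fps_txM k (u : fps_st) n j :
  (fps_of_poly ('X ^+ k)%:P * u) n j = if (k <= j)%N then u n (j - k)%N else 0.
Proof.
elim: k j => [|k IHk] j; first by rewrite expr0 rmorph1 mul1r subn0.
by rewrite exprS polyCM rmorphM -mulrA t_coef; case: j.
Qed.

(** The generator [i] has degree [d i], which accounts for the factor [t^(d i)]. *)
Lemma count_standard n j : (count (standard_term n j) (terms n j))%:R =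
  (\sum_i fps_of_poly ('X ^+ d i)%:P * gf c (standard_words i)) n j.
Proof.
rewrite !fps_sum count_flatten sumnE !big_map big_filter big_enum_cond natr_sum.
rewrite big_mkcond; apply: eq_bigr => i _; rewrite inE /= fps_txM; case: ifP => // le.
rewrite count_map count_filter.
rewrite (@eq_in_count _ _ (standard_words i)) // => u.
rewrite /= mem_words => /and3P[/eqP un uc /eqP wu].
by rewrite /standard_words un uc wu subnKC // andbC.
Qed.

Definition span_elt n j : M n -> Prop :=
  span_of (V := kspace (M n)) (terms n j) (elt n) xpredT.

Hypothesis y_homog : forall i, gr_comp (d i)%:Z (y i).

Lemma gr_comp_kscale n j k (q : kspace (M n)) :
  gr_comp j (q : M n) -> gr_comp j (k *: q : M n).
Proof.
move=> qj; rewrite kscaleE -[j]add0r; apply: (gr_Z (gr_compP M)) qj.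
by rewrite -alg_mpolyC; apply: dhomogZ; apply: dhomog1.
Qed.

Lemma elt_homog n j x : x \in terms n j -> gr_comp j%:Z (elt n x : M n).
Proof.
case: x => i u; rewrite mem_terms /= => /and4P[/eqP un uc /eqP um /eqP <-].
have [e eu] := matches_exists un um.
rewrite (eltE eu) addnC PoszD; apply: (gr_Z (gr_compP M)).
  exact: monomial_homog.
by apply: (gr_map (gr_compP M)).
Qed.

Lemma span_elt_homog n j (q : M n) : span_elt j q -> gr_comp j%:Z q.
Proof.
elim=> [|k _ p [x /andP[xn _] ->] _ IHp]; first exact: (gr_0 (gr_compP M)).
by apply: (gr_D (gr_compP M)) IHp; apply: gr_comp_kscale; apply: elt_homog.
Qed.

(** The equation is required for every large enough range of summation, so that
    two decompositions can be added without aligning their ranges. *)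
Definition decomposable n (q : kspace (M n)) : Prop :=
  exists N (h : nat -> kspace (M n)), (forall j, span_elt j (h j)) /\
    forall N', (N <= N')%N -> q = \sum_(j < N') h j.

Lemma decomposable0 n : decomposable (0 : kspace (M n)).
Proof.
exists 0%N, (fun=> 0); split=> [j|N' _]; first exact: lspan0.
by rewrite big1.
Qed.

Lemma decomposableD n (p q : kspace (M n)) :
  decomposable p -> decomposable q -> decomposable (p + q).
Proof.
move=> [N [h [hP pE]]] [N1 [h1 [h1P qE]]].
exists (maxn N N1), (fun j => h j + h1 j); split=> [j|N'].
  by apply: lspanD; [apply: hP | apply: h1P].
by rewrite geq_max big_split => /andP[/pE <- /qE <-].
Qed.

Lemma decomposable_elt n j k x : x \in terms n j -> decomposable (k *: elt n x).
Proof.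
move=> xn; exists j.+1, (fun i => if i == j then k *: elt n x else 0); split.
  move=> i; case: eqP => [->|_]; last exact: lspan0.
  by apply: lspanZ; apply: lspan_mem; exists x; rewrite ?xn.
move=> N' ltj; rewrite (bigD1 (Ordinal ltj)) //= eqxx big1 ?addr0 // => i.
by rewrite -val_eqE /= => /negbTE ->.
Qed.

Lemma decomposable_gen n i (e : OIhom (w i) n) (p : OIalg K c n) :
  decomposable (p *: oi_map e (y i) : M n).
Proof.
rewrite [p]mpolyE scaler_suml.
elim/big_rec: _ => [|a q _ qP]; first exact: decomposable0.
apply: decomposableD qP; rewrite -mul_mpolyC -scalerA -(monomial_word_of K e a).
rewrite -eltE ?matches_word_of //.
apply: (@decomposable_elt _ (d i + weight (word_of e a))).
rewrite mem_terms /= size_word_of columns_word_of !eqxx andbT /=.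
by apply/eqP; apply: matches_count (matches_word_of _ _); rewrite size_word_of.
Qed.

Hypothesis y_gen : forall N : (forall n, M n -> Prop), is_oi_submodule N ->
  (forall i, N (w i) (y i)) -> forall n (q : M n), N n q.

(** The multiples of the images of the generators span an OI-submodule, and each
    of them is a combination of monomials. *)
Lemma decomposable_all n (q : M n) : decomposable q.
Proof.
pose A n (z : kspace (M n)) := exists i (e : OIhom (w i) n) (p : OIalg K c n),
  z = p *: oi_map e (y i) :> M n.
suff : lspan (@A n) q.
  elim=> [|k _ p [i [e [a ->]]] _ IHp]; first exact: decomposable0.
  by apply: decomposableD IHp; rewrite kscaleE scalerA; apply: decomposable_gen.
move: n q; apply: (y_gen (N := fun n q => lspan (@A n) q)); last first.
  move=> i; apply: lspan_mem; exists i, (OIid (w i)), 1.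
  by rewrite scale1r oi_map_id.
split=> [n|n p q|n a q|m n e q].
- exact: lspan0.
- exact: lspanD.
- elim=> [|k x p [i [e [b ->]]] _ IHp]; first by rewrite scaler0; apply: lspan0.
  rewrite (kspace_scale_comm a); apply: lspanS IHp.
  by exists i, e, (a * b); rewrite scalerA.
- elim=> [|k x p [i [e' [b ->]]] _ IHp].
    have /eqP := oi_mapD e (0 : M m) 0.
    by rewrite addr0 -subr_eq subrr => /eqP <-; apply: lspan0.
  rewrite (kspace_oi_map e); apply: lspanS IHp.
  by exists i, (OIcomp e e'), (OIpush e b); rewrite oi_mapZ oi_map_comp.
Qed.

(** Comparing the components of degree [j] discards the monomials of the other
    degrees. *)
Lemma homogeneous_span n j (q : M n) : gr_comp j%:Z q -> span_elt j q.
Proof.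
move=> qj; have [N [h [hP qE]]] := decomposable_all q.
pose N' := maxn N j.+1.
pose g (z : int) : M n := (if z is Posz i then h i : M n else 0) -
  (if z == j%:Z then q else 0).
(* [g] is the decomposition of [q - q = 0], with one [q] placed in degree [j] *)
suff gj : g j%:Z = 0.
  by move/eqP: gj; rewrite /g eqxx subr_eq0 => /eqP <-.
apply: (gr_direct (gr_compP M) (s := [seq Posz i | i <- iota 0 N'])).
- by rewrite map_inj_uniq ?iota_uniq // => i i' [].
- move=> z; rewrite /g -scaleN1r; apply: (gr_D (gr_compP M)).
    by case: z => [i|i]; [apply: span_elt_homog | apply: (gr_0 (gr_compP M))].
  have -> : (-1 : OIalg K c n) = (-1)%:MP by rewrite mpolyCN mpolyC1.
  apply: gr_comp_kscale.
  by case: eqP => [->|_] //; apply: (gr_0 (gr_compP M)).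
- rewrite big_map -[N' in iota 0 N']subn0 -/(index_iota 0 N') big_mkord /g sumrB /=.
  rewrite -(qE N') ?leq_maxl //.
  have ltj : (j < N')%N by rewrite leq_max ltnSn orbT.
  rewrite (bigD1 (Ordinal ltj)) //= eqxx big1 ?addr0 ?subrr // => i.
  by rewrite -val_eqE /= eqz_nat => /negbTE ->.
- by rewrite map_f // mem_iota /= leq_max ltnSn orbT.
Qed.

Lemma is_Kdim_standard n j :
  is_Kdim (@gr_comp _ _ M n j%:Z) (count (standard_term n j) (terms n j)).
Proof.
rewrite -size_filter.
set B := in_tuple [seq x <- terms n j | standard_term n j x].
exists (fun k => elt n (tnth B k)); split=> [k|k|q qj].
- apply: elt_homog; have := mem_tnth k B.
  by rewrite mem_filter => /andP[].
- exact: (standard_independent term_le_total term_le_trans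
           (V := kspace (M n)) (terms_uniq n j)).
- apply: (standard_spans (V := kspace (M n))).
  apply: (span_standard term_le_total term_le_trans term_le_anti).
  exact: homogeneous_span.
Qed.

End GeneratedModule.

(** * Rationality of the equivariant Hilbert series *)

(** Replace each generator by its homogeneous components. Those of negative degree
    vanish, so taking absolute values of degrees is harmless. *)
Lemma homogeneous_generators (K : fieldType) c (M : graded_oi_module K c) :
  finitely_generated M -> trivial_in_negative_degrees M ->
  exists r (w d : 'I_r -> nat) (y : forall i, M (w i)),
    (forall i, gr_comp (d i)%:Z (y i)) /\
    forall N : (forall n, M n -> Prop), is_oi_submodule N ->
      (forall i, N (w i) (y i)) -> forall n (q : M n), N n q.
Proof.
move=> [r [w [x xgen]]] Mneg.
have xdec i : exists sh : seq int * (int -> M (w i)),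
    (forall j, gr_comp j (sh.2 j)) /\ x i = \sum_(j <- sh.1) sh.2 j.
  by have [s [h shP]] := gr_sum (gr_compP M) (x i); exists (s, h).
pose s i := (sval (cid (xdec i))).1; pose h i := (sval (cid (xdec i))).2.
have [hP xE] : (forall i j, gr_comp j (h i j)) /\
    (forall i, x i = \sum_(j <- s i) h i j).
  by split=> i; have [] := svalP (cid (xdec i)).
pose J := {i : 'I_r & 'I_(size (s i))}.
pose deg (b : J) := nth 0 (s (tag b)) (tagged b).
pose y (b : J) : M (w (tag b)) := h (tag b) (deg b).
exists #|{: J}|, (fun k => w (tag (enum_val k))), (fun k => `|deg (enum_val k)|%N),
  (fun k => y (enum_val k)); split=> [k|N Nsub Ny].
  move: (enum_val k) => b; have := hP (tag b) (deg b); rewrite /y.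
  have [le _|lt hb] := leP 0 (deg b); first by rewrite gez0_abs.
  by rewrite (Mneg _ _ _ lt hb); apply: (gr_0 (gr_compP M)).
apply: xgen => // i; rewrite xE (big_nth 0) big_mkord.
elim/big_rec: _ => [|k q _ Nq]; first exact: oi_sub0.
apply: oi_subD Nq => //; have Nyb b : N _ (y b) by rewrite -[b]enum_rankK; apply: Ny.
exact: (Nyb (Tagged (fun i => 'I_(size (s i))) k)).
Qed.

Lemma fps2_mulE (u v : fps_st) n j : fps2_mul u v n j = (u * v) n j.
Proof. by rewrite fpsM fps_sum. Qed.

Lemma rational_form_quotient (H : fps_st) : rational_form H ->
  exists (a b : nat) (e : 'I_b -> nat) (g : {poly {poly int}})
         (f : 'I_b -> {poly int}),
    (forall j, 0 < (f j).[1] /\ (f j).[0] = 1) /\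
    fps2_quotient H (fps2_poly g) (fps2_poly (hilbert_denominator a e f)).
Proof.
move=> [a [l [g [lP Hg]]]].
exists a, (size l), (fun j => (tnth (in_tuple l) j).1), g,
  (fun j => (tnth (in_tuple l) j).2).
split=> [j|].
  by have /(allP lP)/andP[? /eqP] := mem_tnth j (in_tuple l).
have [v vE] := rational_form_denominator_unit a l.
rewrite big_tnth in Hg vE; exists v; split=> n j; rewrite fps2_mulE.
  by have := congr1 (fun u : fps_st => u n j) vE; rewrite -(rmorph1 fps_of_poly).
have -> : H = fps_of_poly g * v by rewrite -Hg mulrAC vE mul1r.
by [].
Qed.

Theorem theorem1p1 (K : fieldType) (c : nat) (hc : (0 < c)%N)
    (M : graded_oi_module K c) (hfg : finitely_generated M)
    (hneg : trivial_in_negative_degrees M) :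
  exists H : fps2, is_hilbert_series M H /\
    exists (a b : nat) (e : 'I_b -> nat) (g : {poly {poly int}})
           (f : 'I_b -> {poly int}),
      (forall j, 0 < (f j).[1] /\ (f j).[0] = 1) /\
      fps2_quotient H (fps2_poly g) (fps2_poly (hilbert_denominator a e f)).
Proof.
have [r [w [d [y [y_homog y_gen]]]]] := homogeneous_generators hfg hneg.
exists (fun n j => (count (standard_term d y n j) (terms c w d n j))%:R).
split=> [n j|].
  exists (count (standard_term d y n j) (terms c w d n j)); last by rewrite natz.
  exact: is_Kdim_standard.
apply: rational_form_quotient.
have -> : (fun n j => (count (standard_term d y n j) (terms c w d n j))%:R) =
    \sum_i fps_of_poly ('X ^+ d i)%:P * gf c (standard_words d y i) :> fps_st.
  by apply/funext=> n; apply/funext=> j; apply: count_standard.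
apply: rational_form_sum => i; apply: rational_formMpoly.
exact/lower_language_rational/standard_words_lower.
Qed.
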